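(* Let $K$ be an algebraically closed field of characteristic $0$, let $\eta\in K$ with $\eta\neq 0,1$, and let $A=A_\eta$. Then the following are equivalent: (i) all finite dimensional $A_\eta$-modules are semisimple; (ii) every Verma module for $A_\eta$ has composition length $\leq 2$; (iii) $\eta\notin X_{m,n}$ for all integers $m,n\geq 1$ with $m\neq n$.
   Context: For $\alpha,\beta,\gamma\in K$, the down-up algebra $A(\alpha,\beta,\gamma)$ is the associative unital $K$-algebra with generators $d,u$ and defining relations $d^2u=\alpha\, dud+\beta\, ud^2+\gamma d$ and $du^2=\alpha\, udu+\beta\, u^2d+\gamma u$. For $\eta\in K\setminus\{0\}$, $A_\eta$ denotes the down-up algebra $A(\alpha,\beta,\gamma)$ with $\alpha=1+\eta$, $\beta=-\eta$ and $\gamma\neq 0$ (up to isomorphism the choice of nonzero $\gamma$ does not matter, and $A_\eta$ is isomorphic to the algebra with generators $h,e,f$ and relations $he-eh=e$, $hf-fh=-f$, $ef-\eta fe=h$). For $\lambda\in K$ put $\lambda_{-1}=0$, $\lambda_0=\lambda$ and $\lambda_n=\alpha\lambda_{n-1}+\beta\lambda_{n-2}+\gamma$ for $n\geq 1$. The Verma module $V(\lambda)$ has $K$-basis $\{v_n\mid n\geq 0\}$ with action $dv_0=0$, $dv_n=\lambda_{n-1}v_{n-1}$ for $n\geq 1$, and $uv_n=v_{n+1}$ for $n\geq 0$. For integers $m,n\geq 1$, $X_{m,n}=\{\eta\in K^*\mid \eta^m\neq 1\neq \eta^n \text{ and } n(\eta^m-1)=m(\eta^n-1)\}$. *)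

(* Defs.v *)
From HB Require Import structures.
From mathcomp Require Import all_boot all_order all_algebra.
From mathcomp Require Import finmap boolp.
From mathcomp.multinomials Require Import monalg.
From mathcomp Require Import ring.

Set Implicit Arguments.
Unset Strict Implicit.
Unset Printing Implicit Defensive.

Import GRing.Theory.
Local Open Scope ring_scope.
Local Open Scope quotient_scope.

Section DownUpAlgebra.
Variables (K : fieldType) (alpha beta gamma : K).

(* K<d, u>: the algebra of the free monoid on two letters, true being the
   letter d and false the letter u. *)
Local Notation free_du := {malg K[{fmonom bool}]}.

Definition free_d : free_du := << fmu true >>.
Definition free_u : free_du := << fmu false >>.

Definition du_relator (i : bool) : free_du :=
  let d := free_d in let u := free_u in
  if i then d * d * u - (alpha *: (d * u * d) + beta *: (u * d * d) + gamma *: d)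
  else d * u * u - (alpha *: (u * d * u) + beta *: (u * u * d) + gamma *: u).

Definition du_ideal_prop (x : free_du) : Prop :=
  exists s : seq (free_du * bool * free_du),
    x = \sum_(t <- s) t.1.1 * du_relator t.1.2 * t.2.

Definition du_ideal : {pred free_du} := fun x => `[< du_ideal_prop x >].

Lemma du_idealP x : reflect (du_ideal_prop x) (x \in du_ideal).
Proof. exact: asboolP. Qed.

Lemma du_ideal_zmod : zmod_closed du_ideal.
Proof.
split; first by apply/du_idealP; exists [::]; rewrite big_nil.
move=> x y /du_idealP[s ->] /du_idealP[t ->]; apply/du_idealP.
exists (s ++ [seq (- r.1.1, r.1.2, r.2) | r <- t]).
rewrite big_cat big_map /= -sumrN; congr (_ + _).
by apply: eq_bigr => r _; rewrite !mulNr.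
Qed.

HB.instance Definition _ := GRing.isZmodClosed.Build free_du du_ideal du_ideal_zmod.

Lemma du_idealMl a x : x \in du_ideal -> a * x \in du_ideal.
Proof.
move=> /du_idealP[s ->]; apply/du_idealP.
exists [seq (a * r.1.1, r.1.2, r.2) | r <- s].
by rewrite big_map mulr_sumr; apply: eq_bigr => r _; rewrite /= !mulrA.
Qed.

Lemma du_idealMr a x : x \in du_ideal -> x * a \in du_ideal.
Proof.
move=> /du_idealP[s ->]; apply/du_idealP.
exists [seq (r.1.1, r.1.2, r.2 * a) | r <- s].
by rewrite big_map mulr_suml; apply: eq_bigr => r _; exact/esym/mulrA.
Qed.

Lemma du_relatorI i : du_relator i \in du_ideal.
Proof.
by apply/du_idealP; exists [:: (1, i, 1)]; rewrite big_seq1 mul1r mulr1.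
Qed.

Lemma du_ideal1 : 1 \notin du_ideal.
Proof.
apply/negP => /du_idealP[s] /(congr1 (fun g => g@_mone)).
have cd : free_d@_mone = 0 by rewrite mcoeffU1 fm1_eq1.
have cu : free_u@_mone = 0 by rewrite mcoeffU1 fm1_eq1.
have [mcM' mc1] := mcoeff1g_is_multiplicative {fmonom bool} K.
have mcM (x y : free_du) : (x * y)@_mone = x@_mone * y@_mone by exact: mcM'.
rewrite mc1 raddf_sum /= big1 => [/eqP|t _]; first by rewrite oner_eq0.
rewrite !mcM [(du_relator _)@__](_ : _ = 0) ?mulr0 ?mul0r //.
have Z0 (c : K) (x : free_du) : x@_mone = 0 -> (c *: x)@_mone = 0.
  by move=> x0; rewrite mcoeffZ x0 mulr0.
have D0 (x y : free_du) : x@_mone = 0 -> y@_mone = 0 -> (x + y)@_mone = 0.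
  by move=> x0 y0; rewrite mcoeffD x0 y0 addr0.
have lin0 (x y z w : free_du) : x@_mone = 0 -> y@_mone = 0 -> z@_mone = 0 ->
    w@_mone = 0 -> (x - (alpha *: y + beta *: z + gamma *: w))@_mone = 0.
  move=> x0 y0 z0 w0; rewrite mcoeffB x0 sub0r; apply/eqP; rewrite oppr_eq0.
  exact/eqP/(D0 _ _ (D0 _ _ (Z0 _ _ y0) (Z0 _ _ z0)) (Z0 _ _ w0)).
have mul0 (x y : free_du) : y@_mone = 0 -> (x * y)@_mone = 0.
  by move=> y0; rewrite mcM y0 mulr0.
rewrite /du_relator; case: ifP => _; apply: lin0.
- exact: (mul0 _ _ cu).
- exact: (mul0 _ _ cd).
- exact: (mul0 _ _ cd).
- exact: cd.
- exact: (mul0 _ _ cu).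
- exact: (mul0 _ _ cu).
- exact: (mul0 _ _ cd).
- exact: cu.
Qed.

Definition down_up : Type := ring_quotient.Quotient.quot du_ideal.
HB.instance Definition _ := GRing.Zmodule.on down_up.

Definition du_pi (x : free_du) : down_up :=
  \pi_(ring_quotient.Quotient.quot du_ideal) x.

Lemma du_pi_eq x y : du_pi x = du_pi y <-> x - y \in du_ideal.
Proof. by rewrite ring_quotient.Quotient.idealrBE; split=> [/eqP|/eqP]. Qed.

Lemma du_piP (a : down_up) : {x | a = du_pi x}.
Proof. by exists (repr a); rewrite /du_pi reprK. Qed.

End DownUpAlgebra.

Arguments down_up {K} alpha beta gamma.
Arguments du_pi {K} alpha beta gamma x.

(* The constants and operations are locked because a failed unification would
   otherwise unfold them down to monoid-algebra computations. *)
HB.lock Definition du_one (K : fieldType) (alpha beta gamma : K) :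
  down_up alpha beta gamma := du_pi alpha beta gamma 1.
Canonical du_one_unlock := Unlockable du_one.unlock.

HB.lock Definition du_d (K : fieldType) (alpha beta gamma : K) :
  down_up alpha beta gamma := du_pi alpha beta gamma (free_d K).
Canonical du_d_unlock := Unlockable du_d.unlock.

HB.lock Definition du_u (K : fieldType) (alpha beta gamma : K) :
  down_up alpha beta gamma := du_pi alpha beta gamma (free_u K).
Canonical du_u_unlock := Unlockable du_u.unlock.

HB.lock Definition du_mul (K : fieldType) (alpha beta gamma : K)
    (a b : down_up alpha beta gamma) : down_up alpha beta gamma :=
  du_pi alpha beta gamma (repr a * repr b).
Canonical du_mul_unlock := Unlockable du_mul.unlock.

HB.lock Definition du_scale (K : fieldType) (alpha beta gamma c : K)
    (a : down_up alpha beta gamma) : down_up alpha beta gamma :=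
  du_pi alpha beta gamma (c *: repr a).
Canonical du_scale_unlock := Unlockable du_scale.unlock.

Section DownUpTheory.
Variables (K : fieldType) (alpha beta gamma : K).

Local Notation free_du := {malg K[{fmonom bool}]}.
Local Notation free_d := (free_d K).
Local Notation free_u := (free_u K).
Local Notation du_relator := (du_relator alpha beta gamma).
Local Notation du_ideal := (du_ideal alpha beta gamma).
Local Notation down_up := (down_up alpha beta gamma).
Local Notation du_pi := (@du_pi K alpha beta gamma).
Local Notation du_one := (@du_one K alpha beta gamma).
Local Notation du_d := (@du_d K alpha beta gamma).
Local Notation du_u := (@du_u K alpha beta gamma).
Local Notation du_mul := (@du_mul K alpha beta gamma).
Local Notation du_scale := (@du_scale K alpha beta gamma).

Lemma du_repr_pi x : repr (du_pi x) - x \in du_ideal.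
Proof. by apply/du_pi_eq; rewrite /du_pi reprK. Qed.

Lemma du_oneE : du_one = du_pi 1. Proof. by rewrite unlock. Qed.
Lemma du_dE : du_d = du_pi free_d. Proof. by rewrite unlock. Qed.
Lemma du_uE : du_u = du_pi free_u. Proof. by rewrite unlock. Qed.

Lemma du_addE x y : du_pi x + du_pi y = du_pi (x + y).
Proof. by rewrite /du_pi [RHS]ring_quotient.Quotient.pi_add. Qed.

Lemma du_mulE x y : du_mul (du_pi x) (du_pi y) = du_pi (x * y).
Proof.
rewrite unlock; apply/du_pi_eq.
set x' := repr _; set y' := repr _.
have -> : x' * y' - x * y = x' * (y' - y) + (x' - x) * y.
  by rewrite mulrBr mulrBl addrA subrK.
apply: rpredD; first exact/du_idealMl/du_repr_pi.
exact/du_idealMr/du_repr_pi.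
Qed.

Lemma du_scaleE c x : du_scale c (du_pi x) = du_pi (c *: x).
Proof.
rewrite unlock; apply/du_pi_eq.
by rewrite -scalerBr -mul_malgC; exact/du_idealMl/du_repr_pi.
Qed.

Lemma du_mulA : associative du_mul.
Proof.
move=> a b c; have [x ->] := du_piP a; have [y ->] := du_piP b.
by have [z ->] := du_piP c; rewrite !du_mulE mulrA.
Qed.

Lemma du_mul1r : left_id du_one du_mul.
Proof. by move=> a; have [x ->] := du_piP a; rewrite du_oneE du_mulE mul1r. Qed.

Lemma du_mulr1 : right_id du_one du_mul.
Proof. by move=> a; have [x ->] := du_piP a; rewrite du_oneE du_mulE mulr1. Qed.

Lemma du_mulDl : left_distributive du_mul +%R.
Proof.
move=> a b c; have [x ->] := du_piP a; have [y ->] := du_piP b.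
by have [z ->] := du_piP c; rewrite !(du_mulE, du_addE) mulrDl.
Qed.

Lemma du_mulDr : right_distributive du_mul +%R.
Proof.
move=> a b c; have [x ->] := du_piP a; have [y ->] := du_piP b.
by have [z ->] := du_piP c; rewrite !(du_mulE, du_addE) mulrDr.
Qed.

Lemma du_one_neq0 : du_one != 0.
Proof.
apply/eqP => E; have : du_one = du_one + du_one by rewrite {2}E add0r.
rewrite du_oneE du_addE => /du_pi_eq.
by rewrite opprD addrA subrr sub0r rpredN (negbTE (du_ideal1 _ _ _)).
Qed.

HB.instance Definition _ := GRing.Zmodule_isNzRing.Build down_up
  du_mulA du_mul1r du_mulr1 du_mulDl du_mulDr du_one_neq0.

Lemma du_scaleA c e a : du_scale c (du_scale e a) = du_scale (c * e) a.
Proof. by have [x ->] := du_piP a; rewrite !du_scaleE scalerA. Qed.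

Lemma du_scale1r : left_id 1 du_scale.
Proof. by move=> a; have [x ->] := du_piP a; rewrite du_scaleE scale1r. Qed.

Lemma du_scaleDr : right_distributive du_scale +%R.
Proof.
move=> c a b; have [x ->] := du_piP a; have [y ->] := du_piP b.
by rewrite !(du_scaleE, du_addE) scalerDr.
Qed.

Lemma du_scaleDl a : {morph du_scale^~ a : c e / c + e}.
Proof.
by move=> c e; have [x ->] := du_piP a; rewrite !(du_scaleE, du_addE) scalerDl.
Qed.

HB.instance Definition _ := GRing.Zmodule_isLmodule.Build K down_up
  du_scaleA du_scale1r du_scaleDr du_scaleDl.

Lemma du_scaleAl (c : K) (a b : down_up) : c *: (a * b) = c *: a * b.
Proof.
have [x ->] := du_piP a; have [y ->] := du_piP b.
rewrite -[RHS]/(du_mul (du_scale c (du_pi x)) (du_pi y)).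
rewrite -[LHS]/(du_scale c (du_mul (du_pi x) (du_pi y))).
by rewrite !(du_scaleE, du_mulE) scalerAl.
Qed.

HB.instance Definition _ := GRing.Lmodule_isLalgebra.Build K down_up du_scaleAl.

Lemma free_scaleAr (c : K) (x y : free_du) : c *: (x * y) = x * (c *: y).
Proof.
have cC (g : free_du) : c%:MP * g = g * c%:MP.
  rewrite [RHS]malgM_def [LHS]malgM_def fgmulUg fgmulgU.
  by apply: eq_bigr => k _; rewrite mul1m mulm1 mulrC.
by rewrite -[LHS]mul_malgC -[c *: y]mul_malgC !mulrA cC.
Qed.

Lemma du_scaleAr (c : K) (a b : down_up) : c *: (a * b) = a * (c *: b).
Proof.
have [x ->] := du_piP a; have [y ->] := du_piP b.
rewrite -[RHS]/(du_mul (du_pi x) (du_scale c (du_pi y))).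
rewrite -[LHS]/(du_scale c (du_mul (du_pi x) (du_pi y))).
by rewrite !(du_scaleE, du_mulE) free_scaleAr.
Qed.

HB.instance Definition _ := GRing.Lalgebra_isAlgebra.Build K down_up du_scaleAr.

Lemma du_rel_d : du_d * du_d * du_u =
  alpha *: (du_d * du_u * du_d) + beta *: (du_u * du_d * du_d) + gamma *: du_d.
Proof.
rewrite -[_ * _]/(du_mul (du_mul _ _) _).
rewrite -[X in alpha *: X]/(du_mul (du_mul _ _) _).
rewrite -[X in beta *: X]/(du_mul (du_mul _ _) _).
rewrite -[alpha *: _]/(du_scale _ _) -[beta *: _]/(du_scale _ _).
rewrite -[gamma *: _]/(du_scale _ _).
rewrite du_dE du_uE !(du_mulE, du_scaleE, du_addE); apply/du_pi_eq.
exact: (du_relatorI _ _ _ true).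
Qed.

Lemma du_rel_u : du_d * du_u * du_u =
  alpha *: (du_u * du_d * du_u) + beta *: (du_u * du_u * du_d) + gamma *: du_u.
Proof.
rewrite -[_ * _]/(du_mul (du_mul _ _) _).
rewrite -[X in alpha *: X]/(du_mul (du_mul _ _) _).
rewrite -[X in beta *: X]/(du_mul (du_mul _ _) _).
rewrite -[alpha *: _]/(du_scale _ _) -[beta *: _]/(du_scale _ _).
rewrite -[gamma *: _]/(du_scale _ _).
rewrite du_dE du_uE !(du_mulE, du_scaleE, du_addE); apply/du_pi_eq.
exact: (du_relatorI _ _ _ false).
Qed.

Lemma down_up_ind (P : down_up -> Prop) :
    P 0 -> (forall a b, P a -> P b -> P (a + b)) ->
    (forall c a, P a -> P (c *: a)) -> P 1 ->
    (forall a, P a -> P (du_d * a)) -> (forall a, P a -> P (du_u * a)) ->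
  forall a, P a.
Proof.
move=> P0 PD PZ P1 Pd Pu a; have [x ->] := du_piP a.
have Pw (w : seq bool) : P (du_pi << FMonom w >>).
  elim: w => [|i w IHw].
    have -> : << FMonom [::] >> = 1 :> free_du by rewrite -fmoneE.
    by rewrite -du_oneE.
  have -> : << FMonom (i :: w) >> = << fmu i >> * << FMonom w >> :> free_du.
    rewrite [RHS]malgM_def fgmulUU mulr1; congr (<< _ *g _ >>).
    by rewrite /mul /= fmmulE fmuE.
  rewrite -du_mulE; case: i.
    by rewrite -/free_d -du_dE; exact: (Pd _ IHw).
  by rewrite -/free_u -du_uE; exact: (Pu _ IHw).
rewrite [x]monalgE; elim/big_ind: _ => [|y z Py Pz|k _].
- suff -> : du_pi 0 = 0 by [].
  by apply: (addrI (du_pi 0)); rewrite du_addE !addr0.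
- by rewrite -du_addE; apply: PD.
have -> : << x@_k *g k >> = x@_k *: << k >> :> free_du.
  apply/malgP => l; rewrite mcoeffU; apply/esym.
  by rewrite [LHS]mcoeffZ mcoeffU mulrnAr mulr1.
by rewrite -du_scaleE; apply: PZ; case: k => w; apply: Pw.
Qed.

Record du_rep (V : lmodType K) : Type := DuRep {
  rep_d : {linear V -> V};
  rep_u : {linear V -> V};
  rep_rel_d : forall v, rep_d (rep_d (rep_u v)) =
    alpha *: rep_d (rep_u (rep_d v)) + beta *: rep_u (rep_d (rep_d v))
    + gamma *: rep_d v;
  rep_rel_u : forall v, rep_d (rep_u (rep_u v)) =
    alpha *: rep_u (rep_d (rep_u v)) + beta *: rep_u (rep_u (rep_d v))
    + gamma *: rep_u v
}.

Definition rep_mod (V : lmodType K) (r : du_rep V) : Type := V.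

Section RepModule.
Variables (V : lmodType K) (r : du_rep V).

Definition word_act (w : seq bool) (v : V) : V :=
  foldr (fun i => if i then rep_d r else rep_u r) v w.

Definition free_act (x : free_du) (v : V) : V :=
  \sum_(k <- msupp x) x@_k *: word_act k v.

Lemma free_actEw (E : {fset {fmonom bool}}) x v : {subset msupp x <= E} ->
  free_act x v = \sum_(k <- E) x@_k *: word_act k v.
Proof.
move=> sub; apply: big_fset_incl; first exact/fsubsetP.
by move=> k _ /mcoeff_outdom ->; rewrite scale0r.
Qed.

Lemma free_act_is_linear v : linear (free_act^~ v).
Proof.
move=> c x y; pose E := (msupp x `|` msupp y)%fset.
have Ex : {subset msupp x <= E} by apply/fsubsetP/fsubsetUl.
have Ey : {subset msupp y <= E} by apply/fsubsetP/fsubsetUr.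
rewrite (free_actEw _ Ex) (free_actEw _ Ey) (@free_actEw E); last first.
  move=> k; apply: contraTT => kE.
  rewrite -!mcoeff_neq0 mcoeffD mcoeffZ negbK.
  by rewrite !mcoeff_outdom ?mulr0 ?addr0 //; apply: contraNN kE; [exact: Ey|exact: Ex].
rewrite scaler_sumr -big_split /=; apply: eq_bigr => k _.
by rewrite mcoeffD mcoeffZ scalerDl scalerA.
Qed.

Lemma free_act0 v : free_act 0 v = 0.
Proof. by rewrite /free_act msupp0 big_seq_fset0. Qed.

Lemma free_actD v : {morph free_act^~ v : x y / x + y}.
Proof.
move=> x y; have := free_act_is_linear v 1 x y.
by rewrite !scale1r.
Qed.

Lemma free_actZ c x v : free_act (c *: x) v = c *: free_act x v.
Proof.
by have := free_act_is_linear v c x 0; rewrite free_act0 !addr0.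
Qed.

Lemma free_act_sum I (s : seq I) (F : I -> free_du) v :
  free_act (\sum_(i <- s) F i) v = \sum_(i <- s) free_act (F i) v.
Proof. exact: (big_morph _ (free_actD v) (free_act0 v)). Qed.

Lemma free_actU c k v : free_act << c *g k >> v = c *: word_act k v.
Proof.
rewrite (@free_actEw [fset k]%fset) ?big_seq_fset1 ?mcoeffUU //.
exact/fsubsetP/msuppU_le.
Qed.

Lemma word_act_is_linear w : linear (word_act w).
Proof.
move=> c x y; elim: w => //= i w ->.
by case: i; rewrite linearP.
Qed.

Lemma free_actDr x v w : free_act x (v + w) = free_act x v + free_act x w.
Proof.
rewrite /free_act -big_split /=; apply: eq_bigr => k _.
by rewrite -[v]scale1r word_act_is_linear !scale1r scalerDr.
Qed.

Lemma word_act_free_act w x v :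
  word_act w (free_act x v) =
  \sum_(k <- msupp x) x@_k *: word_act w (word_act k v).
Proof.
have wD : {morph word_act w : a b / a + b}.
  by move=> a b; rewrite -[a]scale1r word_act_is_linear !scale1r.
have w0 : word_act w 0 = 0.
  by apply: (addrI (word_act w 0)); rewrite -wD !addr0.
rewrite /free_act (big_morph _ wD w0); apply: eq_bigr => k _.
by rewrite -[_ *: _]addr0 word_act_is_linear w0 addr0.
Qed.

Lemma free_actM x y v : free_act (x * y) v = free_act x (free_act y v).
Proof.
rewrite malgME free_act_sum; apply: eq_bigr => k _.
rewrite free_act_sum word_act_free_act scaler_sumr; apply: eq_bigr => l _.
by rewrite free_actU fmM scalerA /word_act foldr_cat.
Qed.

Lemma free_act_d v : free_act free_d v = rep_d r v.
Proof. by rewrite free_actU scale1r fmU. Qed.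

Lemma free_act_u v : free_act free_u v = rep_u r v.
Proof. by rewrite free_actU scale1r fmU. Qed.

Lemma free_act1 v : free_act 1 v = v.
Proof. by rewrite free_actU scale1r fm1. Qed.

Lemma free_act_ideal x v : x \in du_ideal -> free_act x v = 0.
Proof.
have act_sub y z w : free_act (y - z) w = free_act y w - free_act z w.
  by rewrite -[- z]scaleN1r free_actD free_actZ scaleN1r.
have actr0 y : free_act y 0 = 0.
  by apply: (addrI (free_act y 0)); rewrite -free_actDr !addr0.
move=> /du_idealP[s ->]; rewrite free_act_sum big1 // => t _.
rewrite !free_actM (_ : free_act (du_relator _) _ = 0) ?actr0 //.
have lin0 a b c e w A B C E :
    free_act a w = A -> free_act b w = B -> free_act c w = C ->
    free_act e w = E -> A = alpha *: B + beta *: C + gamma *: E ->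
  free_act (a - (alpha *: b + beta *: c + gamma *: e)) w = 0.
  have Z k y X : free_act y w = X -> free_act (k *: y) w = k *: X.
    by move=> <-; exact: free_actZ.
  have D y z X Y : free_act y w = X -> free_act z w = Y ->
      free_act (y + z) w = X + Y by move=> <- <-; exact: free_actD.
  move=> ea eb ec ee eq; rewrite act_sub ea.
  rewrite (D _ _ _ _ (D _ _ _ _ (Z _ _ _ eb) (Z _ _ _ ec)) (Z _ _ _ ee)).
  by rewrite eq subrr.
have mul3 a b c A B C w : free_act a =1 A -> free_act b =1 B ->
    free_act c =1 C -> free_act (a * b * c) w = A (B (C w)).
  by move=> ea eb ec; rewrite !free_actM ec eb ea.
have Ed := free_act_d; have Eu := free_act_u.
rewrite /du_relator; case: ifP => _.
  exact: (lin0 _ _ _ _ _ _ _ _ _ (mul3 _ _ _ _ _ _ _ Ed Ed Eu)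
    (mul3 _ _ _ _ _ _ _ Ed Eu Ed) (mul3 _ _ _ _ _ _ _ Eu Ed Ed)
    (Ed _) (rep_rel_d r _)).
exact: (lin0 _ _ _ _ _ _ _ _ _ (mul3 _ _ _ _ _ _ _ Ed Eu Eu)
    (mul3 _ _ _ _ _ _ _ Eu Ed Eu) (mul3 _ _ _ _ _ _ _ Eu Eu Ed)
    (Eu _) (rep_rel_u r _)).
Qed.

Fact rep_key : unit. Proof. by []. Qed.

Definition rep_act : down_up -> V -> V :=
  locked_with rep_key (fun a v => free_act (repr a) v).

Lemma rep_actE x v : rep_act (du_pi x) v = free_act x v.
Proof.
rewrite /rep_act [locked_with _ _]unlock -[X in free_act X v](subrK x) free_actD.
by rewrite (free_act_ideal _ (du_repr_pi x)) add0r.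
Qed.

HB.instance Definition _ := GRing.Zmodule.copy (rep_mod r) V.

Lemma rep_actA (a b : down_up) v : rep_act a (rep_act b v) = rep_act (a * b) v.
Proof.
have [x ->] := du_piP a; have [y ->] := du_piP b.
by rewrite -[_ * _]/(du_mul _ _) du_mulE !rep_actE free_actM.
Qed.

Lemma rep_act1 : left_id 1 rep_act.
Proof. by move=> v; rewrite -[1]/du_one du_oneE rep_actE free_act1. Qed.

Lemma rep_actDr : right_distributive rep_act +%R.
Proof.
by move=> a v w; have [x ->] := du_piP a; rewrite !rep_actE free_actDr.
Qed.

Lemma rep_actDl v : {morph rep_act^~ v : a b / a + b}.
Proof.
move=> a b; have [x ->] := du_piP a; have [y ->] := du_piP b.
by rewrite du_addE !rep_actE free_actD.
Qed.

HB.instance Definition _ := GRing.Zmodule_isLmodule.Build down_up (rep_mod r)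
  rep_actA rep_act1 rep_actDr rep_actDl.

Lemma rep_modd (v : rep_mod r) : du_d *: v = rep_d r v.
Proof. by rewrite -[LHS]/(rep_act du_d v) du_dE rep_actE free_act_d. Qed.

Lemma rep_modu (v : rep_mod r) : du_u *: v = rep_u r v.
Proof. by rewrite -[LHS]/(rep_act du_u v) du_uE rep_actE free_act_u. Qed.

Lemma rep_modK (c : K) (v : V) : (c%:A : down_up) *: (v : rep_mod r) = c *: v.
Proof.
rewrite -[LHS]/(rep_act (du_scale c du_one) v) du_oneE du_scaleE rep_actE.
by rewrite free_actZ free_act1.
Qed.

End RepModule.

(* verma_weight lambda n is lambda_{n-1}, starting at lambda_{-1} = 0. *)
Fixpoint verma_weight (lambda : K) (n : nat) : K :=
  match n with
  | 0 => 0
  | 1 => lambda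
  | (p.+1 as q).+1 =>
      alpha * verma_weight lambda q + beta * verma_weight lambda p + gamma
  end.

Section Verma.
Variable lambda : K.
Local Notation lam := (verma_weight lambda).

(* The basis vector v_n is 'X^n. *)
Definition verma_d (p : {poly K}) : {poly K} :=
  \poly_(i < size p) (lam i.+1 * p`_i.+1).
Definition verma_u (p : {poly K}) : {poly K} := 'X * p.

Lemma coef_verma_d p i : (verma_d p)`_i = lam i.+1 * p`_i.+1.
Proof.
rewrite coef_poly; case: ltnP => // le_p_i.
by rewrite nth_default ?mulr0 // (leq_trans le_p_i).
Qed.

Lemma verma_d_is_linear : linear verma_d.
Proof.
move=> c p q; apply/polyP => i.
by rewrite !(coefD, coefZ, coef_verma_d) mulrDr mulrCA.
Qed.
HB.instance Definition _ :=
  GRing.isLinear.Build K {poly K} {poly K} *:%R verma_d verma_d_is_linear.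

Lemma verma_u_is_linear : linear verma_u.
Proof. by move=> c p q; rewrite /verma_u mulrDr scalerAr. Qed.
HB.instance Definition _ :=
  GRing.isLinear.Build K {poly K} {poly K} *:%R verma_u verma_u_is_linear.

Lemma coef_verma_u p i : (verma_u p)`_i = if i is j.+1 then p`_j else 0.
Proof. by rewrite coefXM; case: i. Qed.

Lemma verma_rel_d p : verma_d (verma_d (verma_u p)) =
  alpha *: verma_d (verma_u (verma_d p)) + beta *: verma_u (verma_d (verma_d p))
  + gamma *: verma_d p.
Proof.
apply/polyP => i; rewrite !(coefD, coefZ, coef_verma_d, coef_verma_u) /=.
case: i => [|i]; rewrite ?(coef_verma_d, coef_verma_u) /=; ring.
Qed.

Lemma verma_rel_u p : verma_d (verma_u (verma_u p)) =
  alpha *: verma_u (verma_d (verma_u p)) + beta *: verma_u (verma_u (verma_d p))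
  + gamma *: verma_u p.
Proof.
apply/polyP => i; rewrite !(coefD, coefZ, coef_verma_d, coef_verma_u) /=.
case: i => [|[|i]]; rewrite ?(coef_verma_d, coef_verma_u) /=; ring.
Qed.

Definition verma_rep : du_rep {poly K} := DuRep verma_rel_d verma_rel_u.

Definition verma : lmodType down_up := rep_mod verma_rep.

Definition verma_basis (n : nat) : verma := 'X^n : {poly K}.

Lemma verma_d0 : du_d *: verma_basis 0 = 0.
Proof.
rewrite rep_modd; apply/polyP => i.
by rewrite [LHS]coef_verma_d coefXn mulr0 coef0.
Qed.

Lemma verma_dS n :
  du_d *: verma_basis n.+1 = (lam n.+1)%:A *: verma_basis n.
Proof.
rewrite rep_modd rep_modK; apply/polyP => i.
rewrite [LHS]coef_verma_d coefZ !coefXn eqSS.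
by case: eqP => [->|_] //; rewrite !mulr0.
Qed.

Lemma verma_uE n : du_u *: verma_basis n = verma_basis n.+1.
Proof. by rewrite rep_modu /verma_basis exprS. Qed.

End Verma.

End DownUpTheory.

Arguments verma {K} alpha beta gamma lambda.

Section ModuleNotions.
Variables (R : pzRingType) (M : lmodType R).

Definition simple_submod (S : {pred M}) : Prop :=
  [/\ submod_closed S, exists2 x, x \in S & x != 0
    & forall T : {pred M}, submod_closed T -> {subset T <= S} ->
        T =i pred1 0 \/ T =i S].

Definition direct_sum (I : choiceType) (S : I -> {pred M}) : Prop :=
  (forall x : M, exists (s : seq I) (f : I -> M),
     (forall i, f i \in S i) /\ x = \sum_(i <- s) f i) /\
  (forall (s : seq I) (f : I -> M), uniq s -> (forall i, f i \in S i) ->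
     \sum_(i <- s) f i = 0 -> forall i, i \in s -> f i = 0).

Definition semisimple : Prop :=
  exists (I : choiceType) (S : I -> {pred M}),
    (forall i, simple_submod (S i)) /\ direct_sum S.

(* The last clause says that the factor S i.+1 / S i is simple: it is nonzero
   and no submodule lies strictly between S i and S i.+1. *)
Definition composition_series (n : nat) (S : nat -> {pred M}) : Prop :=
  [/\ forall i, (i <= n)%N -> submod_closed (S i),
      S 0 =i pred1 0,
      S n =i predT
    & forall i, (i < n)%N ->
      [/\ {subset S i <= S i.+1},
          exists2 x, x \in S i.+1 & x \notin S i
        & forall T : {pred M}, submod_closed T ->
            {subset S i <= T} -> {subset T <= S i.+1} ->
            T =i S i \/ T =i S i.+1]].

(* The composition length is infinite when there is no composition series. *)
Definition composition_length_le (l : nat) : Prop :=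
  exists (n : nat) (S : nat -> {pred M}), (n <= l)%N /\ composition_series n S.

End ModuleNotions.

(* K acts on an A-module through the scalars c%:A of A. *)
Definition finite_dimensional (K : fieldType) (A : algType K)
    (M : lmodType A) : Prop :=
  exists (n : nat) (e : 'I_n -> M), forall v : M, exists c : 'I_n -> K,
    v = \sum_i ((c i)%:A : A) *: e i.

Definition X_set (K : fieldType) (m n : nat) : {pred K} :=
  [pred eta : K | [&& eta != 0, eta ^+ m != 1, eta ^+ n != 1 &
    n%:R * (eta ^+ m - 1) == m%:R * (eta ^+ n - 1)]].

(* Main.v *)
Require Import Defs.
From mathcomp Require Import all_boot all_order all_algebra.
From mathcomp Require Import boolp ring.
From HB Require Import structures.

(* Put [delta = gamma / (1 - eta)] and [h = d u - u d - delta]; then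
   [h u = eta u h], [d h = eta h d], and [v_n] in the Verma module of highest
   weight [lambda] satisfies [d v_n = ((lambda - delta) [n] + n delta) v_(n-1)]
   with [[n] = 1 + eta + ... + eta^(n-1)]. Two of these weights, for [m != n],
   vanish for a common [lambda] exactly when [eta \in X_set m n]. The
   submodules of a Verma module correspond to the zeros of its weights, and
   truncating at the larger of two zeros gives a uniserial module that is not
   simple; so (i) and (ii) each force (iii), and (iii) gives (ii).

   For (iii) -> (i), let [M] be finite dimensional. Since [h d] is a multiple of
   [d h] by a scalar other than 1, [tr (h d^j) = 0] for [j > 0], while
   [tr ((d u - u d) d^j) = 0]; hence [tr (d^j) = 0] and [d] is nilpotent, as is
   [u]. Then [ker d] is spanned by vectors [v] killed by some [[n] h + n delta],
   and (iii) implies [ker d :&: im u = 0], so that [u^n v = 0] and [v] generates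
   a simple module. The dual statement is [M = ker d + u M], whence [M] is the
   sum of these simple modules. *)

Set Implicit Arguments.
Unset Strict Implicit.
Unset Printing Implicit Defensive.

Import GRing.Theory.
Local Open Scope ring_scope.

(** * Highest weight vectors *)

Definition qnum (R : pzSemiRingType) (eta : R) (n : nat) : R :=
  \sum_(i < n) eta ^+ i.

Lemma qnum0 (R : pzSemiRingType) (eta : R) : qnum eta 0 = 0.
Proof. exact: big_ord0. Qed.

Lemma qnumSr (R : pzSemiRingType) (eta : R) n :
  qnum eta n.+1 = qnum eta n + eta ^+ n.
Proof. exact: big_ord_recr. Qed.

Lemma qnumSl (R : pzSemiRingType) (eta : R) n :
  qnum eta n.+1 = 1 + eta * qnum eta n.
Proof.
rewrite /qnum big_ord_recl expr0 big_distrr /=; congr (_ + _).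
by apply: eq_bigr => i _; rewrite exprS.
Qed.

Lemma qnumD (R : pzSemiRingType) (eta : R) m n :
  qnum eta (m + n) = qnum eta m + eta ^+ m * qnum eta n.
Proof.
rewrite /qnum big_split_ord big_distrr /=; congr (_ + _).
by apply: eq_bigr => i _; rewrite exprD.
Qed.

Lemma qnumM_subr1 (R : pzRingType) (eta : R) n :
  (eta - 1) * qnum eta n = eta ^+ n - 1.
Proof. by rewrite subrX1. Qed.

Section IterLinear.
Variables (R : pzRingType) (V : lmodType R) (f : {linear V -> V}) (n : nat).

Lemma iter_is_linear : linear (iter n f).
Proof. by move=> a x y; elim: n => //= k ->; rewrite linearP. Qed.

HB.instance Definition _ :=
  GRing.isLinear.Build R V V *:%R (iter n f) iter_is_linear.

End IterLinear.

Section HarishChandra.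
Variables (K : fieldType) (eta delta : K) (V : lmodType K).
Variables (d u h : {linear V -> V}).
Hypotheses (charK0 : [pchar K] =i pred0) (eta_neq0 : eta != 0).
Hypothesis delta_neq0 : delta != 0.
Hypothesis qnum_inj : forall m n, m != n -> qnum eta m.+1 != 0 ->
  n.+1%:R * qnum eta m.+1 != m.+1%:R * qnum eta n.+1.
Hypothesis duE : forall v, d (u v) = u (d v) + h v + delta *: v.
Hypothesis huE : forall v, h (u v) = eta *: u (h v).
Hypothesis dhE : forall v, d (h v) = eta *: h (d v).

Lemma natS_neq0 n : n.+1%:R != 0 :> K.
Proof. by move/pcharf0P: charK0 => ->. Qed.

(** Each [u] that [d] passes leaves a term in [h]. Moving this [h] past the remaining [u^k] costs a
    factor [eta^k], and these powers add up to the q-number. *)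
Lemma d_iter_u n v : d (iter n.+1 u v) =
  iter n.+1 u (d v) + iter n u (qnum eta n.+1 *: h v + (n.+1%:R * delta) *: v).
Proof.
have h_iter k w : h (iter k u w) = eta ^+ k *: iter k u (h w).
  elim: k => [|k IHk] /=; first by rewrite scale1r.
  by rewrite huE IHk linearZ scalerA exprS.
elim: n => [|n IHn].
  by rewrite /= duE qnumSr qnum0 add0r expr0 mul1r scale1r addrA.
rewrite iterS duE IHn h_iter [qnum eta n.+2]qnumSr -[n.+2%:R]natr1.
set c := qnum _ _; rewrite mulrDl mul1r !scalerDl !linearD !linearZ /= -!addrA.
congr (_ + _); congr (_ + _); by rewrite addrCA.
Qed.

Lemma iter_d_u n v : iter n.+1 d (u v) = u (iter n.+1 d v) +
  (qnum eta n.+1 *: h (iter n d v) + (n.+1%:R * delta) *: iter n d v).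
Proof.
elim: n => [|n IHn].
  by rewrite /= duE qnumSr qnum0 add0r expr0 mul1r scale1r addrA.
rewrite iterS IHn !linearD !linearZ /= duE dhE [qnum eta n.+2]qnumSl
  -[n.+2%:R]natr1.
rewrite mulrDl mul1r !scalerDl scale1r !scalerA -!addrA.
congr (_ + _); congr (_ + _); rewrite addrC -!addrA; congr (_ + _).
by rewrite mulrC.
Qed.

Hypothesis d_nilp : forall v, exists n, iter n d v = 0.
Hypothesis u_nilp : forall v, exists n, iter n u v = 0.

Lemma uh0 v : u v = 0 -> u (h v) = 0.
Proof.
move=> uv0; apply/eqP; rewrite -(inj_eq (scalerI eta_neq0)) scaler0 -huE.
by rewrite uv0 linear0.
Qed.

Lemma duh0 v : d (u v) = 0 -> d (u (h v)) = 0.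
Proof.
move=> duv0; apply/eqP; rewrite -(inj_eq (scalerI eta_neq0)) scaler0.
by rewrite -linearZ -huE dhE duv0 linear0 scaler0.
Qed.

(* On the kernel of [d u], if [d^(k+1) w = 0] then [d^k] kills the image of [w]
   under an affine polynomial in [h], and similarly for [u]. A root common to a
   factor of the first kind and one of the second would be a weight at which two
   weights of a single Verma module vanish. *)
Lemma ker_d_im_u w : d (u w) = 0 -> u w = 0.
Proof.
have [N] := d_nilp w; elim: N w => [|k IHk] w dw0 duw0;
  first by rewrite [w]dw0 linear0.
(* The induction hypothesis is applied to [w' = [k+1] h w + eta^k (k+1) delta w]. The factor [eta^k]
   comes from moving [d^k] past [h]; then [d^k w' = 0] because [d^(k+1)] kills both [w] and
   [u w]. *)
have uw'0 : qnum eta k.+1 *: u (h w) + (eta ^+ k * (k.+1%:R * delta)) *: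
  u w = 0.
  rewrite -!linearZ -linearD; apply: IHk; last first.
    by rewrite !linearD !linearZ /= duh0 // duw0 !scaler0 addr0.
  have dh n v : iter n d (h v) = eta ^+ n *: h (iter n d v).
    by elim: n => [|n IHn] /=;
      rewrite ?scale1r // IHn linearZ /= dhE scalerA -exprSr.
  have := iter_d_u k w; rewrite iterSr duw0 dw0 !linear0 add0r => /esym H0.
  rewrite linearD 2!linearZ /= dh -[RHS](scaler0 _ (eta ^+ k)) -H0.
  by rewrite scalerDr !scalerA [qnum _ _ * _]mulrC linearZ.
have [n] := u_nilp (u w); rewrite -iterSr => unw0 {IHk dw0}.
elim: n w unw0 duw0 uw'0 => [|j IHj] w unw0 duw0 uw'0 //.
(* The counterpart for powers of [u], applied to [w'' = eta [j+1] h w + (j+1) delta w]; the extra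
   [eta] is that of [h u = eta u h]. The relation [uw'0] passes from [w] to [w'']. *)
have uw''0 : (eta * qnum eta j.+1) *: u (h w) + (j.+1%:R * delta) *: u w = 0.
  rewrite -!linearZ -linearD; apply: IHj.
  - have := d_iter_u j (u w); rewrite -iterSr unw0 duw0 !linear0 add0r => /esym.
    rewrite huE scalerA [_ * eta]mulrC -![in iter j _ _]linearZ -linearD => H.
    by rewrite iterSr.
  - by rewrite !linearD !linearZ /= duh0 // duw0 !scaler0 addr0.
  - rewrite !(linearD, linearZ) /= ?scalerDr.
    rewrite addrACA -!scalerDr uw'0 scaler0 addr0.
    have uhw'0 : u (h (qnum eta k.+1 *: h w +
                       (eta ^+ k * (k.+1%:R * delta)) *: w)) = 0.
      by apply: uh0; rewrite !(linearD, linearZ).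
    by rewrite !linearD !linearZ /= in uhw'0; rewrite uhw'0 scaler0.
have [q0|q0] := eqVneq (qnum eta k.+1) 0.
  move: uw'0; rewrite q0 scale0r add0r => /eqP; rewrite scaler_eq0.
  by rewrite !mulf_eq0 expf_eq0 (negPf eta_neq0) andbF (negPf (natS_neq0 _))
    (negPf delta_neq0) => /eqP.
have: (qnum eta k.+1 * (j.+1%:R * delta) - (eta * qnum eta j.+1) * (eta ^+ k *
  (k.+1%:R * delta))) *: u w = 0.
  rewrite scalerBl -!scalerA.
  move/eqP: uw''0; rewrite addrC addr_eq0 => /eqP; rewrite -scalerA => ->.
  move/eqP: uw'0; rewrite addrC addr_eq0 -!scalerA => /eqP ->.
  by rewrite !scalerN opprK !scalerA [qnum _ _ * _]mulrC addNr.
move/eqP; rewrite scaler_eq0 => /orP[|/eqP//].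
(* This is the determinant of the two relations between [u (h w)] and [u w]. Since [[k+j+2] = [k+1]
   + eta^(k+1) [j+1]], it is [delta] times the difference that [qnum_inj] shows to be nonzero for
   the indices [k] and [k+j+1]. *)
have -> : qnum eta k.+1 * (j.+1%:R * delta) -
   eta * qnum eta j.+1 * (eta ^+ k * (k.+1%:R * delta)) =
   delta * ((k + j.+1).+1%:R * qnum eta k.+1 - k.+1%:R * qnum eta (k +
     j.+1).+1).
  by rewrite -addSn qnumD natrD exprS; ring.
rewrite mulf_eq0 (negPf delta_neq0) subr_eq0 /= (negPf (qnum_inj _ q0)) //.
by rewrite -[X in X == _]addn0 eqn_add2l.
Qed.

(** A highest weight vector whose weight makes [d u^(n+1) v] vanish. Written without division, the
    condition also holds for [v = 0], so that summands of a decomposition may be zero. *)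
Definition singular (n : nat) (v : V) : Prop :=
  d v = 0 /\ qnum eta n.+1 *: h v + (n.+1%:R * delta) *: v = 0.

Lemma singular_eigen n v : singular n v -> v != 0 ->
  qnum eta n.+1 != 0 /\ h v = - (n.+1%:R * delta / qnum eta n.+1) *: v.
Proof.
move=> [_ hv] v0; have qn0 : qnum eta n.+1 != 0.
  apply: contra_neq v0 => qn0; move/eqP: hv.
  rewrite qn0 scale0r add0r scaler_eq0 mulf_eq0 (negPf (natS_neq0 _)).
  by rewrite (negPf delta_neq0) => /eqP.
split=> //; apply: (scalerI qn0); move/eqP: hv; rewrite addr_eq0 => /eqP ->.
by rewrite scalerA mulrN [_ * (_ / _)]mulrC divfK // scaleNr.
Qed.

(** The left-hand side is the weight of index [n+1] in the Verma module whose highest weight is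
    chosen so that the weight of index [m+1] vanishes. *)
Lemma singular_factor_neq0 m n : m != n -> qnum eta m.+1 != 0 ->
  qnum eta n.+1 * - (m.+1%:R * delta / qnum eta m.+1) + n.+1%:R * delta != 0.
Proof.
move=> nemn qm0; have -> : qnum eta n.+1 * - (m.+1%:R * delta / qnum eta m.+1) +
    n.+1%:R * delta = delta / qnum eta m.+1 *
      (n.+1%:R * qnum eta m.+1 - m.+1%:R * qnum eta n.+1) by field.
by rewrite !mulf_neq0 ?invr_eq0 // subr_eq0 qnum_inj.
Qed.

(** A primary decomposition under [h]. If [u^(N+1)] kills [v], then [u^N] kills [F v] with [F =
    [N+1] h + (N+1) delta], and induction decomposes [F v]. On its summands [F] is a nonzero scalar,
    so they lift to a sum [s] with [F s = F v], and [v - s] is the last summand. *)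
Lemma ker_d_decomp N v : d v = 0 -> iter N u v = 0 ->
  exists2 f : nat -> V, v = \sum_(i < N) f i & forall i, singular i (f i).
Proof.
elim: N v => [|N IHN] v dv0 uv0.
  exists (fun=> 0); first by rewrite big_ord0.
  by move=> i; split; rewrite !linear0 ?addr0.
pose F (w : V) := qnum eta N.+1 *: h w + (N.+1%:R * delta) *: w.
have FD x y : F (x + y) = F x + F y by rewrite /F !linearD addrACA.
have FZ c x : F (c *: x) = c *:
  F x by rewrite /F linearZ scalerDr !scalerA ![c * _]mulrC.
have F0 : F 0 = 0 by rewrite /F !linear0 addr0.
have := d_iter_u N v; rewrite uv0 dv0 !linear0 add0r -/(F v) => /esym Fv0.
have dF w : d w = 0 -> d (F w) = 0.
  by move=> dw; rewrite linearD !linearZ /= dhE dw !linear0 addr0.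
have [g Fv sg] := IHN (F v) (dF _ dv0) Fv0.
(* If [[N+1] = 0], then [F] is the nonzero scalar [(N+1) delta], hence already [u^N v = 0] and the
   summand of index [N] is taken to be 0. *)
have [q0|q0] := eqVneq (qnum eta N.+1) 0.
  have /IHN[//|f -> sf] : iter N u v = 0.
    move/eqP: Fv0; rewrite /F q0 scale0r add0r linearZ scaler_eq0.
    by rewrite mulf_eq0 (negPf (natS_neq0 _)) (negPf delta_neq0) => /eqP.
  exists (fun i => if i == N then 0 else f i) => [|i].
    rewrite big_ord_recr /= eqxx addr0; apply: eq_bigr => i _.
    by rewrite ltn_eqF.
  by case: eqP => // _; split; rewrite !linear0 ?addr0.
pose c i := (qnum eta N.+1 * - (i.+1%:R * delta / qnum eta i.+1) +
  N.+1%:R * delta)^-1.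
have cP i : (i < N)%N -> F (c i *: g i) = g i.
  move=> ltiN; have [-> | gi0] := eqVneq (g i) 0; first by rewrite scaler0 F0.
  have [qi0 hgi] := singular_eigen (sg i) gi0.
  rewrite FZ /F hgi scalerA -scalerDl scalerA mulVf ?scale1r //.
  by rewrite singular_factor_neq0 // ltn_eqF.
pose s := \sum_(i < N) c i *: g i.
have Fs : F s = F v.
  rewrite (big_morph F FD F0) Fv; apply: eq_bigr => i _; exact: cP.
exists (fun i => if i == N then v - s else c i *: g i) => [|i].
  rewrite big_ord_recr /= eqxx; transitivity (s + (v - s));
    first by rewrite addrC subrK.
  by congr (_ + _); apply: eq_bigr => i _; rewrite ltn_eqF.
case: eqP => [->|_].
  split; last by rewrite -/(F _) FD -scaleN1r FZ Fs scaleN1r subrr.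
  rewrite linearB linear_sum dv0 big1 ?subrr // => j _.
  by rewrite linearZ /=; have [-> _] := sg j; rewrite scaler0.
have [dg hg] := sg i; split; first by rewrite linearZ /= dg scaler0.
rewrite linearZ -[RHS](scaler0 _ (c i)) -hg scalerDr !scalerA.
by rewrite ![c i * _]mulrC.
Qed.

(** Here [u^(n+1) v] lies in the image of [u] and is killed by [d], so it vanishes by
    [ker_d_im_u]. *)
Lemma singular_top n v : singular n v -> iter n.+1 u v = 0.
Proof.
move=> [dv0 hv]; apply: ker_d_im_u; rewrite -iterS d_iter_u dv0 hv.
by rewrite !linear0 addr0.
Qed.

Lemma singular_d_iter_u i n v : singular n v -> v != 0 -> d (iter i.+1 u v) =
  (qnum eta i.+1 * - (n.+1%:R * delta / qnum eta n.+1) + i.+1%:R * delta)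
    *: iter i u v.
Proof.
move=> sv v0; have [dv0 _] := sv; have [_ hv] := singular_eigen sv v0.
by rewrite d_iter_u dv0 hv linear0 add0r scalerA -scalerDl linearZ.
Qed.

(** With [j] the largest index such that [c j != 0], the power [d^j] kills all lower terms and sends
    [u^j v] to a nonzero multiple of [v]. That multiple is the product of the weights of index 1 to
    [j <= n], none of which vanishes. *)
Lemma singular_highest_weight n v k (c : nat -> K) : singular n v ->
  (k <= n.+1)%N ->
  \sum_(i < k) c i *: iter i u v != 0 ->
  exists j b, b *: iter j d (\sum_(i < k) c i *: iter i u v) = v.
Proof.
move=> sv; have [->|v0] := eqVneq v 0.
  by exists 0%N, 0; rewrite scale0r.
have [qn0 _] := singular_eigen sv v0; have [dv0 _] := sv.
have dui i := singular_d_iter_u i sv v0.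
have pivot j : (j <= n)%N -> exists2 p, p != 0 & iter j d (iter j u v) = p *: v.
  elim: j => [|j IHj] ltjn; first by exists 1; rewrite ?oner_eq0 ?scale1r.
  have [p p0 pE] := IHj (ltnW ltjn); rewrite iterSr dui linearZ /= pE scalerA.
  by eexists; last by []; rewrite mulf_neq0 // singular_factor_neq0 // gtn_eqF.
elim: k => [|k IHk] lekn; first by rewrite big_ord0 eqxx.
rewrite big_ord_recr /=; have [-> | ck0 _] := eqVneq (c k) 0.
  by rewrite scale0r addr0; apply: IHk; exact: ltnW.
have [p p0 pE] := pivot k lekn.
exists k, (c k * p)^-1; rewrite linearD linearZ /= pE linear_sum big1 => [|i _].
  by rewrite add0r !scalerA -mulrA mulVf ?scale1r // mulf_neq0.
have [q _ qE] := pivot i (leq_trans (ltnW (ltn_ord i)) lekn).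
have kE : k = ((k - i.+1).+1 + i)%N by rewrite addSnnS subnK.
by rewrite linearZ /= [in iter k]kE iterD qE iterSr !linearZ /= dv0 !linear0.
Qed.
End HarishChandra.

(** * Nilpotency by traces *)

Section TraceNilpotent.
Variables (K : fieldType) (n : nat).
Hypothesis charK0 : [pchar K] =i pred0.
Implicit Types A B H : 'M[K]_n.+1.

(** The trace of an idempotent is its rank: in a full rank factorization [A = L R], idempotency
    gives [R L = 1]. *)
Lemma idempotent_mxtrace0 A : A * A = A -> \tr A = 0 -> A = 0.
Proof.
move=> idA; have LR := mulmx_base A.
have /row_full_inj Linj := col_base_full A.
have /row_free_inj Rinj := row_base_free A.
move: (col_base A) (row_base A) LR Linj Rinj => L R LR Linj Rinj.
have RL : R *m L = 1%:M.
  apply: Rinj; apply: Linj.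
  by rewrite /= mul1mx !mulmxA LR -mulmxA LR; exact: idA.
rewrite -[in \tr A]LR mxtrace_mulC RL mxtrace_scalar.
by move=> /eqP; move/pcharf0P: charK0 => ->; rewrite mxrank_eq0 => /eqP.
Qed.

(** Eigenvalues are avoided by Fitting's decomposition. The projection [e] onto the part where [A]
    is invertible is a polynomial in [A] without constant term, so its trace is 0 and [e = 0]. *)
Lemma mxtrace_pow0_nilpotent A :
  (forall j, \tr (A ^+ j.+1) = 0) -> exists k, A ^+ k = 0.
Proof.
move=> trA0; have [k [q q0 pE]] := multiplicity_XsubC (char_poly A) 0.
rewrite monic_neq0 ?char_poly_monic //= subr0 in q0 pE.
(* The exponent is [k.+1] and not [k], so that [b * 'X^(k.+1)] has no constant term even when
   [k = 0]. *)
have /Bezout_eq1_coprimepP[[a b] /= ab1] : coprimep q ('X^(k.+1)).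
  by rewrite coprimep_expr // -['X]subr0 coprimep_XsubC.
set e := horner_mx A (b * 'X^(k.+1)).
have qA0 : horner_mx A (q * 'X^(k.+1)) = 0.
  by rewrite exprSr mulrA -pE rmorphM /= Cayley_Hamilton mul0r.
have Ae : A ^+ k.+1 = A ^+ k.+1 * e.
  have -> : A ^+ k.+1 = horner_mx A 'X^(k.+1) by rewrite rmorphXn /=
    horner_mx_X.
  rewrite -rmorphM -[in LHS](mulr1 'X^_) -ab1 mulrDr rmorphD /=.
  by rewrite mulrCA [_ * q]mulrC rmorphM /= qA0 mulr0 add0r.
exists k.+1; rewrite Ae (_ : e = 0) ?mulr0 //.
apply: idempotent_mxtrace0.
  apply/eqP; rewrite eq_sym -subr_eq0 -{1}[e]mulr1 -mulrBr.
  rewrite -(rmorph1 (horner_mx A)) -rmorphB /= -ab1 addrK -rmorphM /=.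
  by rewrite mulrACA [_ * q]mulrC rmorphM /= qA0 mulr0.
rewrite /e -[b]coefK poly_def mulr_suml linear_sum linear_sum big1 //= => i _.
by rewrite -scalerAl -exprD addnS linearZ /= rmorphXn /= horner_mx_X linearZ
  /= trA0 mulr0.
Qed.

(** Stated for any [c != 1] in order to serve both [d], with [c = eta], and [u], with
    [c = eta^-1]. *)
Lemma commutator_scaled_nilpotent A B H (c delta : K) : c != 1 -> delta != 0 ->
  A * B - B * A = H + delta%:M -> H * A = c *: (A * H) -> exists k, A ^+ k = 0.
Proof.
move=> c1 delta0 comm HA; apply: mxtrace_pow0_nilpotent => j.
have trH : \tr (H * A ^+ j.+1) = 0.
  apply/eqP; have : \tr (H * A ^+ j.+1) = c * \tr (H * A ^+ j.+1).
    rewrite {1}exprS mulrA HA -scalerAl linearZ /= -mulrA -mulmxE mxtrace_mulC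
      mulmxE.
    by rewrite -mulrA -exprSr.
  move/eqP; rewrite -subr_eq0 -{1}[\tr _]mul1r -mulrBl mulf_eq0 subr_eq0.
  by rewrite eq_sym (negPf c1).
have : \tr ((A * B - B * A) * A ^+ j.+1) = 0.
  rewrite mulrBl linearB /= -mulrA -mulmxE mxtrace_mulC mulmxE -mulrA -exprSr.
  by rewrite -mulrA -exprS subrr.
rewrite comm mulrDl linearD /= trH add0r -mulmxE mul_scalar_mx linearZ /= =>
  /eqP.
by rewrite mulf_eq0 (negPf delta0) => /eqP.
Qed.

End TraceNilpotent.

(** * Kernels and images of matrices acting on row vectors *)

Lemma kermx_mul0_factor (K : fieldType) m n p (A : 'M[K]_(m, n)) (C :
  'M_(m, p)) :
  kermx A *m C = 0 -> exists B, C = A *m B.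
Proof.
rewrite /kermx -mulmxA => kC.
(* The matrix multiplying [C] is the pseudo-inverse of [A] obtained from its Gaussian
   elimination. *)
exists (invmx (row_ebase A) *m pid_mx (\rank A) *m invmx (col_ebase A) *m C).
have AE : A *m invmx (row_ebase A) = col_ebase A *m pid_mx (\rank A).
  by rewrite -[X in X *m _]mulmx_ebase mulmxK ?row_ebase_unit.
rewrite !mulmxA AE -[_ *m pid_mx _ *m pid_mx _]mulmxA.
rewrite pid_mx_id ?rank_leq_col // -!mulmxA.
rewrite -[LHS](mulKVmx (col_ebase_unit A)); congr (_ *m _).
by move/eqP: kC; rewrite mulmxBl mul1mx subr_eq0 => /eqP.
Qed.

(** The columns of [C] are functionals vanishing on [ker D + im U]. Vanishing on [ker D], [C]
    factors as [D B]; then [U D B = 0] forces [C = 0], so the sum is the whole space. *)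
Lemma kermx_add_full (K : fieldType) n (D U : 'M[K]_n) :
  (forall B : 'M_n, U *m (D *m B) = 0 -> D *m B = 0) ->
  forall r : 'rV_n, exists k t, r = k + t *m U /\ k *m D = 0.
Proof.
move=> UD0 r; set C := cokermx (kermx D + U)%MS.
have kC : kermx D *m C = 0.
  by apply/eqP; rewrite -submxE addsmxSl.
have uC : U *m C = 0 by apply/eqP; rewrite -submxE addsmxSr.
have [B CE] := kermx_mul0_factor kC.
have C0 : C = 0 by rewrite CE UD0 // -CE.
have : (r <= kermx D + U)%MS by rewrite submxE -/C C0 mulmx0.
case/sub_addsmxP => -[a b] /= ->.
by exists (a *m kermx D), b; rewrite -mulmxA mulmx_ker mulmx0.
Qed.

(** * Submodules *)

Section Submodules.
Variables (K : fieldType) (alpha beta gamma : K).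
Local Notation A := (down_up alpha beta gamma).
Local Notation d := (@du_d K alpha beta gamma).
Local Notation u := (@du_u K alpha beta gamma).

Lemma down_up_submod_closed (M : lmodType A) (T : {pred M}) :
    0 \in T -> (forall v w, v \in T -> w \in T -> v + w \in T) ->
    (forall c v, v \in T -> (c%:A : A) *: v \in T) ->
    (forall v, v \in T -> d *: v \in T) -> (forall v, v \in T ->
      u *: v \in T) ->
  submod_closed T.
Proof.
move=> T0 TD TZ Td Tu; split=> // a v w Tv Tw; apply: (TD) => // {w Tw}.
elim/down_up_ind: a => [|a b Ta Tb|c a Ta||a Ta|a Ta].
- by rewrite scale0r.
- by rewrite scalerDl TD.
- by rewrite -mulr_algl -scalerA TZ.
- by rewrite scale1r.
- by rewrite -scalerA Td.
- by rewrite -scalerA Tu.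
Qed.

Lemma submod_closedMl (R : pzRingType) (M : lmodType R) (T : {pred M}) a v :
  submod_closed T -> v \in T -> a *: v \in T.
Proof. by move=> [T0 TL] Tv; rewrite -[_ *: v]addr0 TL. Qed.

Lemma submod_closedDl (R : pzRingType) (M : lmodType R) (T : {pred M}) v w :
  submod_closed T -> v \in T -> w \in T -> v + w \in T.
Proof. by move=> [T0 TL] Tv Tw; rewrite -[v]scale1r TL. Qed.

Lemma rep_submod_closed (V : lmodType K) (r : du_rep alpha beta gamma V)
    (T : {pred V}) :
    0 \in T -> (forall v w, v \in T -> w \in T -> v + w \in T) ->
    (forall c v, v \in T -> c *: v \in T) ->
    (forall v, v \in T -> rep_d r v \in T) ->
    (forall v, v \in T -> rep_u r v \in T) ->
  submod_closed (T : {pred rep_mod r}).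
Proof.
move=> T0 TD TZ Td Tu; apply: down_up_submod_closed => //.
- by move=> c v Tv; rewrite rep_modK TZ.
- by move=> v Tv; rewrite rep_modd Td.
- by move=> v Tv; rewrite rep_modu Tu.
Qed.

Section RepSubmodule.
Variables (V : lmodType K) (r : du_rep alpha beta gamma V) (T : {pred V}).
Hypothesis sT : submod_closed (T : {pred rep_mod r}).

Lemma rep_submod0 : 0 \in T. Proof. by case: sT. Qed.

Lemma rep_submodD v w : v \in T -> w \in T -> v + w \in T.
Proof. exact: (@submod_closedDl _ (rep_mod r)). Qed.

Lemma rep_submodZ c v : v \in T -> c *: v \in T.
Proof. by move=> Tv; have := submod_closedMl (c%:A : A) sT Tv;
  rewrite rep_modK. Qed.

Lemma rep_submod_d v : v \in T -> rep_d r v \in T.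
Proof. by move=> Tv; have := submod_closedMl d sT Tv; rewrite rep_modd. Qed.

Lemma rep_submod_u v : v \in T -> rep_u r v \in T.
Proof. by move=> Tv; have := submod_closedMl u sT Tv; rewrite rep_modu. Qed.

Lemma rep_submod_sum I (s : seq I) (F : I -> V) :
  (forall i, F i \in T) -> \sum_(i <- s) F i \in T.
Proof.
move=> TF; elim/big_ind: _ => // [|v w];
  [exact: rep_submod0|exact: rep_submodD].
Qed.

End RepSubmodule.
End Submodules.

(** * Verma modules *)

Section VermaModules.
Variables (K : fieldType) (alpha beta gamma lambda : K).
Local Notation rep := (verma_rep alpha beta gamma lambda).
Local Notation lam := (verma_weight alpha beta gamma lambda).

(** The span of the basis vectors [v_i = 'X^i] with [i >= n]. *)
Definition low_coef0 (n : nat) : {pred {poly K}} :=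
  [pred p : {poly K} | [forall i : 'I_n, p`_i == 0]].

Lemma low_coef0P n (p : {poly K}) :
  reflect (forall i, (i < n)%N -> p`_i = 0) (p \in low_coef0 n).
Proof.
apply: (iffP forallP) => [p0 i ltin|p0 i]; first exact/eqP/(p0 (Ordinal ltin)).
exact/eqP/p0.
Qed.

Lemma verma_submod n : lam n = 0 ->
  submod_closed (low_coef0 n : {pred verma alpha beta gamma lambda}).
Proof.
move=> lam0; apply: rep_submod_closed => /=.
- by apply/low_coef0P => i _; rewrite coef0.
- move=> p q /low_coef0P p0 /low_coef0P q0; apply/low_coef0P => i ltin.
  by rewrite coefD p0 ?q0 ?addr0.
- move=> c p /low_coef0P p0; apply/low_coef0P => i ltin.
  by rewrite coefZ p0 ?mulr0.
- move=> p /low_coef0P p0; apply/low_coef0P => i ltin.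
  rewrite coef_verma_d; have [->|ne_in] := eqVneq i.+1 n;
    first by rewrite lam0 mul0r.
  by rewrite p0 ?mulr0 // ltn_neqAle ne_in.
- move=> p /low_coef0P p0; apply/low_coef0P => -[|i] ltin.
    by rewrite coef_verma_u.
  by rewrite coef_verma_u p0 // ltnW.
Qed.

Section Submodule.
Variable T : {pred {poly K}}.
Hypothesis sT : submod_closed (T : {pred verma alpha beta gamma lambda}).

Lemma verma_submod_mulXn n p : p \in T -> 'X^n * p \in T.
Proof.
move=> Tp; elim: n => [|n IHn]; first by rewrite expr0 mul1r.
by rewrite exprS -mulrA; exact: (rep_submod_u sT IHn).
Qed.

Lemma verma_submod_Xn_sub n : 'X^n \in T -> {subset low_coef0 n <= T}.
Proof.
move=> Tn p /low_coef0P p0; rewrite -[p]coefK poly_def.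
apply: (rep_submod_sum sT) => i; have [ltin|lein] := ltnP i n.
  by rewrite p0 // scale0r; exact: rep_submod0 sT.
apply: (rep_submodZ sT); rewrite -(subnK lein) exprD.
exact: verma_submod_mulXn.
Qed.

(** Applying [d] lowers the degree by one, the leading coefficient being multiplied by a nonzero
    weight, and [lam n = 0] keeps the result in [low_coef0 n]. After finitely many steps a nonzero
    multiple of ['X^n] is left. *)
Lemma verma_submod_Xn n p : lam n = 0 -> p \in T -> p \in low_coef0 n ->
  p != 0 -> (forall i, (n < i < size p)%N -> lam i != 0) -> 'X^n \in T.
Proof.
move=> lam0; have sn := verma_submod lam0.
have [k] := ubnP (size p); elim: k p => // k IHk p lepk Tp np p0 nz.
have ltnp : (n < size p)%N.
  rewrite ltnNge; apply: contra_neqN p0 => lepn; apply/polyP => i.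
  rewrite coef0; have [ltin|lein] := ltnP i n; first exact: (low_coef0P _ _ np).
  by rewrite nth_default // (leq_trans lepn).
have [pn1|pn1] := eqVneq (size p) n.+1.
  have pE : p = p`_n *: 'X^n.
    apply/polyP => i; rewrite coefZ coefXn.
    have [->|ne_in] := eqVneq i n; rewrite ?mulr1 ?mulr0 //.
    have [ltin|lein] := ltnP i n; first exact: (low_coef0P _ _ np).
    by rewrite nth_default // pn1 ltn_neqAle eq_sym ne_in.
  have pn0 : p`_n != 0 by apply: contra_neq p0 => pn0; rewrite pE pn0 scale0r.
  have -> : 'X^n = (p`_n)^-1 *: p by rewrite {2}pE scalerA mulVf ?scale1r.
  exact: rep_submodZ sT _ _ Tp.
have [m pm] : exists m, size p = m.+2.
  by case: (size p) ltnp pn1 => [|[|m]] //; [case: (n)|exists m].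
have ltnm : (n < m.+1)%N.
  by rewrite pm ltnS leq_eqVlt eq_sym -eqSS -pm (negPf pn1) in ltnp.
have dpm : verma_d alpha beta gamma lambda p != 0.
  have lm : lam m.+1 != 0 by apply: nz; rewrite ltnm pm /=.
  apply: contraNneq lm => dp0.
  have /eqP := congr1 (fun q : {poly K} => q`_m) dp0.
  rewrite coef_verma_d coef0 mulf_eq0 -[p`_m.+1]/(p`_(m.+2.-1)) -pm.
  by rewrite -lead_coefE lead_coef_eq0 (negPf p0) orbF.
have sdp : (size (verma_d alpha beta gamma lambda p) <= m.+1)%N.
  apply/leq_sizeP => i lemi; rewrite coef_verma_d nth_default ?mulr0 //.
  by rewrite pm ltnS.
apply: IHk dpm _.
- by rewrite (leq_ltn_trans sdp) // -ltnS -pm.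
- exact: (rep_submod_d sT Tp).
- exact: (rep_submod_d sn np).
- move=> i /andP[ltni lti]; apply: nz; rewrite ltni pm.
  by rewrite (leq_trans lti) // (leq_trans sdp).
Qed.

End Submodule.

(** If [T] contains some [p] outside [low_coef0 n], it also contains the truncation of [p] below
    degree [n]. This is nonzero, and only weights strictly between [m] and [n] occur on lowering it
    to ['X^m]. *)
Lemma verma_quotient_simple m n (T : {pred {poly K}}) :
    submod_closed (T : {pred verma alpha beta gamma lambda}) ->
    lam m = 0 -> lam n = 0 -> (forall i, (m < i < n)%N -> lam i != 0) ->
    {subset low_coef0 n <= T} -> {subset T <= low_coef0 m} ->
  T =i low_coef0 n \/ T =i low_coef0 m.
Proof.
move=> sT lm ln nz nT Tm.
have [Tn|/existsNP[p /not_implyP[Tp np]]] := pselect (forall p, p \in T ->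
  p \in low_coef0 n).
  by left=> p; apply/idP/idP; [exact: Tn|exact: nT].
right=> q; apply/idP/idP; [exact: Tm|apply: (verma_submod_Xn_sub sT) q].
have pE : p = take_poly n p + drop_poly n p * 'X^n by rewrite poly_take_drop.
have drT : drop_poly n p * 'X^n \in T.
  apply: nT; apply/low_coef0P => i ltin.
  by rewrite coefMXn ltin.
have tpE : take_poly n p = p + (-1) *: (drop_poly n p * 'X^n).
  by rewrite scaleN1r {2}pE addrK.
have tT : take_poly n p \in T.
  by rewrite tpE (rep_submodD sT) ?(rep_submodZ sT).
apply: (verma_submod_Xn sT lm tT (Tm _ tT)) => [|i /andP[ltmi lti]].
  apply: contra_notN np => /eqP t0; apply/low_coef0P => i ltin.
  by rewrite pE t0 add0r coefMXn ltin.
by rewrite nz // ltmi (leq_trans lti) // size_take_poly.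
Qed.

Lemma verma_submod_simple n (T : {pred {poly K}}) :
    submod_closed (T : {pred verma alpha beta gamma lambda}) ->
    lam n = 0 -> (forall i, (n < i)%N -> lam i != 0) ->
    {subset T <= low_coef0 n} ->
  T =i pred1 0 \/ T =i low_coef0 n.
Proof.
move=> sT ln nz Tn.
have [T0|/existsNP[p /not_implyP[Tp /eqP p0]]] :=
  pselect (forall p, p \in T -> p = 0).
  left=> p; apply/idP/idP => [/T0->|/eqP->]; first by rewrite inE.
  exact: rep_submod0 sT.
right=> q; apply/idP/idP; [exact: Tn|apply: (verma_submod_Xn_sub sT) q].
apply: (verma_submod_Xn sT ln Tp (Tn _ Tp) p0) => i /andP[ltni _].
exact: nz.
Qed.

Lemma low_coef00 : low_coef0 0 =i predT.
Proof. by move=> p; apply/low_coef0P. Qed.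

Lemma Xn_low_coef0 n : 'X^n \in low_coef0 n.
Proof. by apply/low_coef0P => i ltin; rewrite coefXn ltn_eqF. Qed.

Lemma Xn_notin_low_coef0 m n : (m < n)%N -> 'X^m \notin low_coef0 n.
Proof.
move=> ltmn; apply/low_coef0P => /(_ m ltmn)/eqP.
by rewrite coefXn eqxx oner_eq0.
Qed.

(** Since [lam 0 = 0], the whole module is [low_coef0 0]. It is simple when no other weight
    vanishes; a single further zero [n.+1] inserts [low_coef0 n.+1] into the series. *)
Lemma verma_composition_length_le2 :
    (forall m n, lam m.+1 = 0 -> lam n.+1 = 0 -> m = n) ->
  composition_length_le (verma alpha beta gamma lambda) 2.
Proof.
move=> lam_inj.
pose Z : {pred verma alpha beta gamma lambda} := pred1 0.
pose F : {pred verma alpha beta gamma lambda} := predT.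
have pred0_closed : submod_closed Z.
  split=> [|a v w]; rewrite ?inE // => /eqP-> /eqP->.
  by rewrite scaler0 addr0.
have predT_closed : submod_closed F by [].
have [[n lamn]|nz] := pselect (exists n, lam n.+1 = 0); last first.
  have {}nz i : (0 < i)%N -> lam i != 0.
    by case: i => // i _; apply/eqP => li; apply: nz; exists i.
  exists 1%N, (fun i => if i is 0 then Z else F); split=> //.
  split=> [[|i] _|||[|i] //] //; split=> //.
    by exists (1 : {poly K}) => //; rewrite inE oner_eq0.
  move=> T sT _ _; case: (@verma_submod_simple 0 T sT erefl nz) =>
    [p _|T0|Tn]; first by rewrite low_coef00.
    by left.
  by right=> p; rewrite Tn low_coef00.
exists 2%N, (fun i => match i with 0 => Z | 1 => low_coef0 n.+1 | _ => F end).
split=> //; split=> [[|[|i]] _|||[|[|i]] //] //=.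
- exact: verma_submod.
- split.
  + by move=> p /eqP->; apply/low_coef0P => i _; rewrite coef0.
  + exists ('X^(n.+1) : {poly K}); first exact: Xn_low_coef0.
    by rewrite inE -size_poly_eq0 size_polyXn.
  + move=> T sT _; apply: (verma_submod_simple sT lamn) => -[//|i] ltni.
    by apply: contraTneq ltni => /lam_inj/(_ lamn)->; rewrite ltnn.
- split=> //.
  + by exists (1 : {poly K}) => //; rewrite -(expr0 'X) Xn_notin_low_coef0.
  + move=> T sT nT _.
    case: (@verma_quotient_simple 0 _ T sT erefl lamn _ nT) =>
      [[//|i] /andP[_ ltin]|p _|Tn|T0].
    * by apply: contraTneq ltin => /lam_inj/(_ lamn)->; rewrite ltnn.
    * by rewrite low_coef00.
    * by left.
    * by right=> p; rewrite T0 low_coef00.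
Qed.

(** In a series of length 2, the simple term [S 1] meets [low_coef0 n.+1], since multiplying by
    ['X^(n.+1)] moves any element there. So [S 1] lies inside it, and [low_coef0 m.+1] is strictly
    between [S 1] and the whole module. *)
Lemma verma_composition_length_gt2 m n : (m < n)%N -> lam m.+1 = 0 ->
  lam n.+1 = 0 ->
  ~ composition_length_le (verma alpha beta gamma lambda) 2.
Proof.
move=> ltmn lm ln [k [S [lek2 [sS S0 Sk simS]]]].
have sm := verma_submod lm; have sn := verma_submod ln.
have Xmm := Xn_low_coef0 m.+1; have X0m := Xn_notin_low_coef0 (ltn0Sn m).
case: k => [|[|[|//]]] in lek2 sS Sk simS.
- have := S0 (1 : {poly K}); rewrite Sk inE => /esym/eqP/eqP.
  by rewrite oner_eq0.
- have [_ _ /(_ _ sm)] := simS 0%N isT; case.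
  + by move=> p; rewrite S0 => /eqP->; apply/low_coef0P => i _; rewrite coef0.
  + by move=> p _; rewrite Sk.
  + move=> E; have := E ('X^(m.+1) : {poly K});
      rewrite Xmm S0 inE => /esym/eqP/eqP.
    by rewrite -size_poly_eq0 size_polyXn.
  + by move=> E; move: X0m; rewrite E Sk.
have [_ [q S1q]] := simS 0%N isT; rewrite S0 inE => q0 simS1.
have sS1 : submod_closed (S 1%N) by exact: sS.
have S1n : {subset S 1%N <= low_coef0 n.+1}.
  pose T : {pred {poly K}} :=
    [pred p | (p \in S 1%N) && (p \in low_coef0 n.+1)].
  have [| |p /andP[]//|T0|TS] := simS1 T.
  - split=> [|a v w /andP[v1 vn] /andP[w1 wn]].
      by rewrite inE (proj1 sS1) (proj1 sn).
    by rewrite inE (proj2 sS1) ?(proj2 sn).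
  - move=> p; rewrite S0 => /eqP->.
    by rewrite inE (proj1 sS1) (proj1 sn).
  - have : ('X^(n.+1) * q : {poly K}) \in T.
      rewrite inE (verma_submod_mulXn sS1) //.
      by apply/low_coef0P => i ltin; rewrite coefXnM ltin.
    by rewrite T0 S0 inE mulf_eq0 expf_eq0 polyX_eq0 andbF (negPf q0).
  - by move=> p; rewrite -TS => /andP[].
have [_ _ /(_ _ sm)] := simS 1%N isT; case.
- move=> p /S1n/low_coef0P pn; apply/low_coef0P => i ltim.
  by rewrite pn // (leq_trans ltim) // ltnW.
- by move=> p _; rewrite Sk.
- move=> E; have /S1n : ('X^(m.+1) : {poly K}) \in S 1%N by rewrite -E.
  by rewrite (negPf (Xn_notin_low_coef0 _)).
- by move=> E; move: X0m; rewrite E Sk.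
Qed.

End VermaModules.

(** * Finite dimensional quotients of Verma modules *)

Section TruncatedVerma.
Variables (K : fieldType) (alpha beta gamma lambda : K) (n : nat).
Local Notation lam := (verma_weight alpha beta gamma lambda).
Local Notation vd := (verma_d alpha beta gamma lambda).
Hypothesis lamn : lam n = 0.

(** The quotient of the Verma module by the span of the [v_i] with [i >= n] is realized on row
    vectors: [poly_rV] is the projection and [rVpoly] a linear section of it. *)
Definition trunc_d : 'rV[K]_n -> 'rV[K]_n := poly_rV \o vd \o rVpoly.
Definition trunc_u : 'rV[K]_n -> 'rV[K]_n := poly_rV \o @verma_u K \o rVpoly.
HB.instance Definition _ := GRing.Linear.on trunc_d.
HB.instance Definition _ := GRing.Linear.on trunc_u.

Lemma coef_rVpoly_poly_rV (p : {poly K}) i :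
  (rVpoly (poly_rV p : 'rV_n))`_i = if (i < n)%N then p`_i else 0.
Proof.
rewrite coef_rVpoly; case: insubP => [j ltin jE|/negPf-> //].
by rewrite mxE ltin jE.
Qed.

(* [lam n = 0] makes the span of the [v_i] with [i >= n] a submodule, so that
   truncation commutes with the action. *)
Lemma trunc_d_poly_rV p : trunc_d (poly_rV p) = poly_rV (vd p).
Proof.
apply/rowP => i; rewrite !mxE !coef_verma_d coef_rVpoly_poly_rV.
case: ltnP => // lein; have /eqP -> : i.+1 == n by rewrite eqn_leq ltn_ord lein.
by rewrite lamn !mul0r.
Qed.

Lemma trunc_u_poly_rV p : trunc_u (poly_rV p) = poly_rV (verma_u p).
Proof.
apply/rowP => -[[|i] ltin]; rewrite !mxE !coef_verma_u //= coef_rVpoly_poly_rV.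
by rewrite ltnW.
Qed.

Lemma trunc_rel_d v : trunc_d (trunc_d (trunc_u v)) =
  alpha *: trunc_d (trunc_u (trunc_d v)) + beta *: trunc_u (trunc_d (trunc_d v))
  + gamma *: trunc_d v.
Proof.
rewrite -[v]rVpolyK !(trunc_d_poly_rV, trunc_u_poly_rV).
by rewrite verma_rel_d !linearD !linearZ.
Qed.

Lemma trunc_rel_u v : trunc_d (trunc_u (trunc_u v)) =
  alpha *: trunc_u (trunc_d (trunc_u v)) + beta *: trunc_u (trunc_u (trunc_d v))
  + gamma *: trunc_u v.
Proof.
rewrite -[v]rVpolyK !(trunc_d_poly_rV, trunc_u_poly_rV).
by rewrite verma_rel_u !linearD !linearZ.
Qed.

Definition trunc_rep : du_rep alpha beta gamma 'rV[K]_n :=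
  DuRep trunc_rel_d trunc_rel_u.

Definition trunc_verma : lmodType (down_up alpha beta gamma) :=
  rep_mod trunc_rep.

Lemma trunc_verma_finite_dimensional : finite_dimensional trunc_verma.
Proof.
exists n, (fun i => delta_mx 0 i : 'rV[K]_n) => v;
  exists (fun i => (v : 'rV[K]_n) 0 i).
rewrite [LHS]row_sum_delta; apply: eq_bigr => i _.
by rewrite rep_modK.
Qed.

Section Submodule.
Variable T : {pred 'rV[K]_n}.
Hypothesis sT : submod_closed (T : {pred trunc_verma}).

Lemma trunc_submod_mulXn m p : poly_rV p \in T -> poly_rV ('X^m * p) \in T.
Proof.
move=> Tp; elim: m => [|m IHm]; first by rewrite expr0 mul1r.
by rewrite exprS -mulrA -trunc_u_poly_rV; exact: (rep_submod_u sT IHm).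
Qed.

(** If [i] is the first index with a nonzero coordinate, [u^(n-1-i)] sends [v] to a nonzero multiple
    of the last basis vector. *)
Lemma trunc_submod_top v : v \in T -> v != 0 -> poly_rV 'X^(n.-1) \in T.
Proof.
move=> Tv v0; have [i0 vi0] : exists i, v 0 i != 0.
  apply/existsP; apply: contra_neqT v0; rewrite negb_exists => /forallP v0.
  by apply/rowP => i; rewrite mxE; apply/eqP; rewrite -[_ == _]negbK v0.
have [i vi imin] := @arg_minnP _ i0 (fun i => v 0 i != 0) val vi0.
have -> : poly_rV 'X^(n.-1) = (v 0 i)^-1 *:
  poly_rV ('X^(n.-1 - i) * rVpoly v) :> 'rV[K]_n.
  apply/rowP => j; rewrite !mxE coefXn coefXnM.
  have lein : (i <= n.-1)%N by rewrite -ltnS (ltn_predK (ltn_ord i)).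
  have lejn : (j <= n.-1)%N by rewrite -ltnS (ltn_predK (ltn_ord j)).
  case: ltnP => [ltj|lej].
    by rewrite mulr0 ltn_eqF // (leq_trans ltj) ?leq_subr.
  have ltjn : (j - (n.-1 - i) < n)%N by rewrite (leq_ltn_trans (leq_subr _ _)).
  rewrite (coef_rVpoly_ord v (Ordinal ltjn)).
  have [jE|nej] := eqVneq (j : nat) n.-1.
    rewrite (_ : Ordinal _ = i) ?mulVf //; apply: val_inj => /=.
    by rewrite jE subKn.
  suff -> : v 0 (Ordinal ltjn) = 0 by rewrite mulr0.
  apply/eqP; rewrite -[_ == _]negbK; apply/negP => /imin; apply/negP.
  by rewrite -ltnNge /= ltn_subLR // subnK // ltn_neqAle nej.
by apply: (rep_submodZ sT); apply: trunc_submod_mulXn; rewrite rVpolyK.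
Qed.

End Submodule.

(** All simple submodules share the last basis vector, so a direct sum of them has only one summand
    and the module would itself be simple. The span of the [v_i] with [i >= m] contradicts this. *)
Lemma trunc_verma_not_semisimple m : (0 < m < n)%N -> lam m = 0 ->
  ~ semisimple trunc_verma.
Proof.
move=> /andP[m0 ltmn] lamm [I [S [simS [genS dirS]]]].
have n0 : (0 < n)%N by exact: leq_ltn_trans ltmn.
pose e i : 'rV[K]_n := poly_rV 'X^i.
have e0 i : (i < n)%N -> e i != 0.
  move=> ltin; apply/eqP => /rowP/(_ (Ordinal ltin))/eqP.
  by rewrite !mxE coefXn eqxx oner_eq0.
have Stop i : e n.-1 \in S i.
  by have [sS [x Sx x0] _] := simS i;
    exact: (@trunc_submod_top (S i) sS x Sx x0).
have top0 : e n.-1 != 0 by rewrite e0 // ltn_predL.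
have Ieq (i j : I) : i = j.
  apply/eqP; apply: contraTT isT => neij.
  have sS k : submod_closed (S k) by case: (simS k).
  pose f k := if k == i then e n.-1 else if k == j then - e n.-1 else 0.
  have : f i = 0.
    apply: (dirS [:: i; j] f) => [|k||]; rewrite ?mem_head //= ?inE ?neij //.
      rewrite /f; case: eqP => // _; case: eqP => _; last by case: (sS k).
      by rewrite -scaleN1r (rep_submodZ (sS k)).
    by rewrite big_cons big_seq1 /f eqxx eq_sym (negPf neij) eqxx subrr.
  by rewrite /f eqxx => /eqP; rewrite (negPf top0).
have [s [f [Sf e0E]]] := genS (e 0%N).
have [i sumi] : exists i, e 0%N \in S i.
  case: s e0E => [|i s] e0E.
    by have := e0 0%N n0; rewrite e0E big_nil eqxx.
  exists i; rewrite e0E; have [sS _ _] := simS i.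
  by apply: (rep_submod_sum sS) => j; rewrite (Ieq i j).
have [sS _ simi] := simS i.
pose T : {pred 'rV[K]_n} := [pred v | rVpoly v \in low_coef0 m].
have sm := verma_submod lamm.
have rV_low (p : {poly K}) : p \in low_coef0 m ->
  rVpoly (poly_rV p : 'rV[K]_n) \in low_coef0 m.
  move=> /low_coef0P pm; apply/low_coef0P => j ltjm.
  by rewrite coef_rVpoly_poly_rV (ltn_trans ltjm ltmn) pm.
have sT : submod_closed (T : {pred trunc_verma}).
  apply: rep_submod_closed => [|v w Tv Tw|c v Tv|v Tv|v Tv].
  - by rewrite inE linear0 (rep_submod0 sm).
  - by rewrite inE linearD (rep_submodD sm).
  - by rewrite inE linearZ (rep_submodZ sm).
  - by rewrite inE; apply: rV_low; exact: (rep_submod_d sm Tv).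
  - by rewrite inE; apply: rV_low; exact: (rep_submod_u sm Tv).
have allS v : v \in S i.
  rewrite -[v]rVpolyK -[rVpoly v]coefK poly_def linear_sum.
  apply: (rep_submod_sum sS) => j; rewrite linearZ.
  apply: (rep_submodZ sS); rewrite -['X^j]mulr1.
  exact: (trunc_submod_mulXn sS).
case: (simi T sT) => [v _|T0|TS]; first exact: allS.
- have : e n.-1 \in T.
    rewrite inE; apply: rV_low; apply/low_coef0P => j ltjm;
      rewrite coefXn ltn_eqF //.
    by rewrite (leq_trans ltjm) // -ltnS (ltn_predK ltmn).
  by rewrite T0 inE (negPf top0).
- have : e 0%N \in T by rewrite TS.
  rewrite inE => /low_coef0P/(_ 0%N m0)/eqP.
  by rewrite coef_rVpoly_poly_rV n0 coefXn oner_eq0.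
Qed.

End TruncatedVerma.

(** * Zeros of the weights and the sets [X_set m n] *)

Section Weights.
Variables (K : fieldType) (eta gamma : K).
Hypotheses (charK0 : [pchar K] =i pred0) (eta_neq1 : eta != 1).
Hypothesis gamma_neq0 : gamma != 0.
Local Notation lam := (verma_weight (1 + eta) (- eta) gamma).
Let delta := gamma / (1 - eta).

(** The recurrence has characteristic roots 1 and [eta], and [n delta] is a particular solution. *)
Lemma verma_weightE lambda n :
  lam lambda n = (lambda - delta) * qnum eta n + n%:R * delta.
Proof.
suff [] : lam lambda n = (lambda - delta) * qnum eta n + n%:R * delta /\
  lam lambda n.+1 = (lambda - delta) * qnum eta n.+1 + n.+1%:R * delta by [].
elim: n => [|n [IH1 IH2]].
  by rewrite /= qnumSr qnum0 expr0; split; ring.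
split=> //; rewrite -[LHS]/((1 + eta) * lam lambda n.+1 + (- eta) * lam lambda
  n + gamma).
have gE : gamma = (1 - eta) * delta by rewrite mulrC divfK // subr_eq0 eq_sym.
rewrite IH1 IH2 !qnumSr exprS gE -[n.+2%:R]natr1 -[n.+1%:R]natr1; ring.
Qed.

Lemma qnum_eq0 n : (qnum eta n == 0) = (eta ^+ n == 1).
Proof.
by rewrite -[RHS]subr_eq0 -qnumM_subr1 mulf_eq0 subr_eq0 (negPf eta_neq1).
Qed.

Lemma qnum_inj_of_X_set : eta != 0 ->
  (forall m n, (0 < m)%N -> (0 < n)%N -> m != n -> eta \notin X_set m n) ->
  forall m n, m != n -> qnum eta m.+1 != 0 ->
  n.+1%:R * qnum eta m.+1 != m.+1%:R * qnum eta n.+1.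
Proof.
move=> eta0 etaX m n nemn qm0; apply: contraTneq isT => E.
have := etaX m.+1 n.+1 isT isT; rewrite eqSS => /(_ nemn).
rewrite inE eta0 -!qnum_eq0 qm0 -!qnumM_subr1 ![_%:R * (_ * _)]mulrCA E eqxx
  andbT.
(* Only [[n+1] = 0] is left to exclude: the equality [E] would give [(n+1) [m+1] = 0]. *)
rewrite negbK => /eqP qn0; move: E; rewrite qn0 mulr0 => /eqP.
by rewrite mulf_eq0 (negPf qm0) orbF; move/pcharf0P: charK0 => ->.
Qed.

Lemma verma_weight_inj :
  (forall m n, m != n -> qnum eta m.+1 != 0 ->
     n.+1%:R * qnum eta m.+1 != m.+1%:R * qnum eta n.+1) ->
  forall lambda m n, lam lambda m.+1 = 0 -> lam lambda n.+1 = 0 -> m = n.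
Proof.
move=> qinj lambda m n; rewrite !verma_weightE => lm ln; apply/eqP.
have d0 : delta != 0 by rewrite mulf_neq0 // invr_eq0 subr_eq0 eq_sym.
have md0 : m.+1%:R * delta != 0.
  by rewrite mulf_neq0 //; move/pcharf0P: charK0 => ->.
have qm0 : qnum eta m.+1 != 0.
  by apply: contra_neq md0 => q0; rewrite -lm q0 mulr0 add0r.
have l0 : lambda - delta != 0.
  by apply: contra_neq md0 => q0; rewrite -lm q0 mul0r add0r.
apply: contraNT l0 => /qinj/(_ qm0) ne; rewrite -subr_eq0 in ne.
suff : (lambda - delta) * (n.+1%:R * qnum eta m.+1 - m.+1%:R * qnum eta n.+1)
  = 0.
  by move/eqP; rewrite mulf_eq0 (negPf ne) orbF.
transitivity (n.+1%:R * ((lambda - delta) * qnum eta m.+1 + m.+1%:R * delta)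
  - m.+1%:R * ((lambda - delta) * qnum eta n.+1 + n.+1%:R * delta));
      first by ring.
by rewrite lm ln !mulr0 subrr.
Qed.

Lemma X_set_verma_weight m n : eta \in X_set m n ->
  exists lambda, lam lambda m = 0 /\ lam lambda n = 0.
Proof.
rewrite inE -!qnum_eq0 => /and4P[_ qm0 qn0 /eqP E].
(* The highest weight is the solution of [lam lambda m = 0]; the equation defining [X_set] makes the
   weight of index [n] vanish as well. *)
exists (delta - m%:R * delta / qnum eta m); rewrite !verma_weightE.
have {}E : n%:R * qnum eta m = m%:R * qnum eta n.
  apply: (mulfI (_ : eta - 1 != 0)); first by rewrite subr_eq0.
  by rewrite !(mulrCA (eta - 1)) !qnumM_subr1.
split; first by field.
have -> : n%:R = m%:R * qnum eta n / qnum eta m by rewrite -E mulfK.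
by field.
Qed.

End Weights.

(** * Modules generated by simple vectors *)

Section SimpleVectors.
Variables (R : pzRingType) (M : lmodType R).
Implicit Types (ws : seq M) (v w x : M).

Definition generated ws x : Prop :=
  forall T : {pred M}, submod_closed T -> {subset ws <= T} -> x \in T.

(** Simplicity of the cyclic module [R v], expressed on its elements. *)
Definition simple_vector v : Prop :=
  v != 0 /\ forall a, a *: v != 0 -> exists b, b *: (a *: v) = v.

Definition independent ws : Prop := forall a : nat -> R,
  \sum_(i < size ws) a i *: ws`_i = 0 ->
  forall i, (i < size ws)%N -> a i *: ws`_i = 0.

Lemma generated0 ws : generated ws 0.
Proof. by move=> T [T0 _] _. Qed.

Lemma generatedD ws x y : generated ws x -> generated ws y ->
  generated ws (x + y).
Proof. by move=> gx gy T sT wsT; rewrite submod_closedDl ?gx ?gy. Qed.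

Lemma generatedZ ws a x : generated ws x -> generated ws (a *: x).
Proof. by move=> gx T sT wsT; rewrite submod_closedMl ?gx. Qed.

Lemma generated_mem ws x : x \in ws -> generated ws x.
Proof. by move=> wsx T _; exact. Qed.

Lemma generated_trans ws ws' x : {in ws, forall w, generated ws' w} ->
  generated ws x -> generated ws' x.
Proof. by move=> gw gx T sT wsT; apply: gx => // w /gw; exact. Qed.

Lemma generated_sum I (s : seq I) (F : I -> M) ws :
  (forall i, generated ws (F i)) -> generated ws (\sum_(i <- s) F i).
Proof.
by move=> gF; elim/big_ind: _ => [|x y gx gy|//];
  [exact: generated0|exact: generatedD].
Qed.

Lemma generatedP ws x :
  generated ws x <-> exists a : nat -> R, x = \sum_(i < size ws) a i *: ws`_i.
Proof.
split=> [gx|[a ->]]; last first.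
  by apply: generated_sum => i; apply/generatedZ/generated_mem/mem_nth.
pose T : {pred M} := [pred x | `[< exists a : nat ->
  R, x = \sum_(i < size ws) a i *: ws`_i >]].
have sT : submod_closed T.
  split=> [|c y z /asboolP[a ->] /asboolP[b ->]]; apply/asboolP.
    by exists (fun=> 0); rewrite big1 // => i _; rewrite scale0r.
  exists (fun i => c * a i + b i); rewrite scaler_sumr -big_split /=.
  by apply: eq_bigr => i _; rewrite scalerDl scalerA.
apply/asboolP/(gx _ sT) => w wsw; apply/asboolP.
have lw : (index w ws < size ws)%N by rewrite index_mem.
exists (fun i => (i == index w ws)%:R); rewrite (bigD1 (Ordinal lw)) //= eqxx.
rewrite scale1r nth_index // big1 ?addr0 // => i /negPf ne.
by rewrite -[_ == _]/(i == Ordinal lw) ne scale0r.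
Qed.

Lemma extract_independent (vs : seq M) : {in vs, forall v, simple_vector v} ->
  exists ws, [/\ {in ws, forall w, simple_vector w}, independent ws
    & forall x, generated vs x -> generated ws x].
Proof.
elim: vs => [|v vs IHvs] simv.
  by exists [::]; split=> // a _ [].
have [|ws [simw indw gw]] := IHvs.
  by move=> w vsw; apply: simv; rewrite inE vsw orbT.
have [gv|ngv] := pselect (generated ws v).
  exists ws; split=> // x; apply: generated_trans => w;
    rewrite inE => /predU1P[->//|vsw].
  exact/gw/generated_mem.
exists (v :: ws); split.
- by move=> w; rewrite inE => /predU1P[->|/simw//]; apply: simv;
    rewrite mem_head.
- move=> a; rewrite big_ord_recl /= => a0.
  have av0 : a 0%N *: v = 0.
    apply/eqP; apply: contra_notT ngv => av0.
    (* Were [a 0 *: v] nonzero, simplicity would recover [v] from it, and the relation would put [v]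
       among the elements generated by [ws]. *)
    have [_ /(_ _ av0)[b <-]] := simv v (mem_head _ _).
    move/eqP: a0; rewrite addr_eq0 => /eqP ->; rewrite scalerN -scaleNr.
    by apply/generatedZ/generatedP; exists (a \o S).
  move: a0; rewrite av0 add0r => a0 [|i] //=; exact: (indw (a \o S)).
- move=> x; apply: generated_trans => w; rewrite inE => /predU1P[->|vsw].
    by apply: generated_mem; rewrite mem_head.
  apply: generated_trans (gw _ (generated_mem vsw)) => y wsy.
  by apply: generated_mem; rewrite inE wsy orbT.
Qed.

Lemma semisimple_of_simple_vectors (vs : seq M) :
  {in vs, forall v, simple_vector v} -> (forall x, generated vs x) ->
    semisimple M.
Proof.
move=> /extract_independent[ws [simw indw gw]] genv.
pose S (i : 'I_(size ws)) : {pred M} :=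
  [pred x | `[< exists a, x = a *: ws`_i >]].
exists 'I_(size ws), S; split=> [i|].
  have [wi0 wiP] := simw _ (mem_nth 0 (ltn_ord i)).
  split.
  - split=> [|c x y /asboolP[a ->] /asboolP[b ->]]; apply/asboolP.
      by exists 0; rewrite scale0r.
    by exists (c * a + b); rewrite scalerDl scalerA.
  - by exists ws`_i => //; apply/asboolP; exists 1; rewrite scale1r.
  - move=> T sT TS.
    have [T0|/existsNP[x /not_implyP[Tx /eqP x0]]] :=
      pselect (forall x, x \in T -> x = 0).
      left=> x; apply/idP/idP => [/T0->|/eqP->]; first by rewrite inE.
      by case: sT.
    right=> y; apply/idP/idP; first exact: TS.
    move=> /asboolP[c ->]; have /asboolP[a xE] := TS _ Tx.
    have [|b <-] := wiP a; first by rewrite -xE.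
    by rewrite -xE !submod_closedMl.
split=> [x|s f us Sf fs0 i si].
  have /gw/generatedP[a ->] := genv x.
  exists (index_enum 'I_(size ws)), (fun i : 'I_(size ws) => a i *: ws`_i);
    split=> // i.
  by apply/asboolP; exists (a i).
have /choice[a fE] : forall i, exists a, f i = a *: ws`_i.
  by move=> j; apply/asboolP/Sf.
(* The relation over the indices in [s] is extended by zero to all positions of [ws]. *)
pose b (k : nat) : R := if insub k is Some j then if j \in s then a j else 0
  else 0.
have bE (j : 'I_(size ws)) : b j *: ws`_j = if j \in s then f j else 0.
  by rewrite /b valK; case: ifP => _; rewrite ?fE ?scale0r.
have := indw b; rewrite (eq_bigr _ (fun j _ =>
  bE j)) -big_mkcond -big_uniq //= fs0.
by move=> /(_ erefl i (ltn_ord i)); rewrite bE si.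
Qed.

End SimpleVectors.

(** * Modules over an algebra as vector spaces *)

Section ScalarRestriction.
Variables (K : fieldType) (A : algType K) (M : lmodType A).

Definition scalar_restriction : Type := M.
Local Notation V := scalar_restriction.
HB.instance Definition _ := GRing.Zmodule.on V.

Let scale (c : K) (v : V) : V := (c%:A : A) *: (v : M).

Fact scalar_restriction_scaleA a b v : scale a (scale b v) = scale (a * b) v.
Proof. by rewrite /scale scalerA -scalerAl mul1r scalerA. Qed.

Fact scalar_restriction_scale1 : left_id 1 scale.
Proof. by move=> v; rewrite /scale scale1r scale1r. Qed.

Fact scalar_restriction_scaleDr : right_distributive scale +%R.
Proof. by move=> c v w; rewrite /scale scalerDr. Qed.

Fact scalar_restriction_scaleDl v : {morph scale^~ v : a b / a + b}.
Proof. by move=> a b; rewrite /scale scalerDl scalerDl. Qed.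

HB.instance Definition _ := GRing.Zmodule_isLmodule.Build K V
  scalar_restriction_scaleA scalar_restriction_scale1
  scalar_restriction_scaleDr scalar_restriction_scaleDl.

Lemma scalar_restrictionE (c : K) (v : M) : c *: (v : V) = (c%:A : A) *: v.
Proof. by []. Qed.

Definition alg_act (a : A) (v : V) : V := a *: (v : M).

Fact alg_act_is_linear a : linear (alg_act a).
Proof.
move=> c v w; rewrite /alg_act !scalar_restrictionE scalerDr !scalerA.
by rewrite mulr_algr mulr_algl.
Qed.
HB.instance Definition _ a :=
  GRing.isLinear.Build K V V *:%R (alg_act a) (alg_act_is_linear a).

Lemma iter_alg_act a n (v : V) : iter n (alg_act a) v = a ^+ n *: (v : M).
Proof.
elim: n => [|n IHn]; first by rewrite expr0 scale1r.
by rewrite iterS IHn exprS -scalerA.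
Qed.

(** A spanning family of least size is a basis, since a nontrivial relation would allow one of its
    vectors to be dropped. *)
Lemma finite_dimensional_coord : finite_dimensional M ->
  exists n (psi : {linear V -> 'rV[K]_n}) (phi : {linear 'rV[K]_n -> V}),
    cancel psi phi /\ cancel phi psi.
Proof.
pose spans n := exists e : 'I_n -> V, forall v, exists c : 'rV[K]_n,
  v = \sum_i c 0 i *: e i.
move=> [n0 [e0 e0P]]; have ex : exists n, `[< spans n >].
  exists n0; apply/asboolP; exists e0 => v; have [c vE] := e0P v.
  by exists (\row_i c i); rewrite vE; apply: eq_bigr => i _; rewrite mxE.
have [n /asboolP[e eP] nmin] := ex_minnP ex.
have inj (c : 'rV[K]_n) : \sum_i c 0 i *: e i = 0 -> c = 0.
  move=> c0; apply/rowP => i; rewrite mxE; apply/eqP; apply: contraT => ci0.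
  case: n i e eP nmin c c0 ci0 => [[]//|n] i e eP nmin c c0 ci0.
  suff /asboolP/nmin : spans n by rewrite ltnn.
  exists (fun j => e (lift i j)) => v; have [a ->] := eP v.
  exists (\row_j (a 0 (lift i j) - a 0 i / c 0 i * c 0 (lift i j))).
  move: c0; rewrite !(bigD1_ord i) //= => /eqP; rewrite addr_eq0 => /eqP cE.
  have -> : a 0 i *: e i = - \sum_j (a 0 i / c 0 i * c 0 (lift i j)) *:
    e (lift i j).
    rewrite -[a 0 i](divfK ci0) -scalerA cE scalerN scaler_sumr.
    by congr (- _); apply: eq_bigr => j _; rewrite scalerA divfK.
  rewrite addrC -sumrB; apply: eq_bigr => j _.
  by rewrite mxE scalerBl.
pose phi0 (c : 'rV[K]_n) : V := \sum_i c 0 i *: e i.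
have phi_lin : linear phi0.
  move=> a c b; rewrite /phi0 scaler_sumr -big_split /=; apply: eq_bigr => i _.
  by rewrite !mxE scalerDl scalerA.
pose phi : {linear 'rV[K]_n ->
  V} := HB.pack phi0 (GRing.isLinear.Build _ _ _ _ phi0 phi_lin).
have /choice[psi0 psiK] : forall v, exists c, v = phi c by move=> v; exact: eP.
have phiK : cancel phi psi0.
  move=> c; apply/eqP; rewrite -subr_eq0; apply/eqP/inj.
  by rewrite -[LHS]/(phi (_ - _)) linearB -psiK subrr.
have psiK' : cancel psi0 phi by move=> v; rewrite -psiK.
pose psi : {linear V -> 'rV[K]_n} :=
  HB.pack psi0 (GRing.isLinear.Build _ _ _ _ psi0 (can2_linear phiK psiK')).
by exists n, psi, phi.
Qed.

End ScalarRestriction.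

(** * Finite dimensional modules *)

Section FiniteDimension.
Variables (K : fieldType) (eta delta : K) (V : lmodType K).
Variables (d u h : {linear V -> V}).
Hypotheses (charK0 : [pchar K] =i pred0) (eta_neq0 : eta != 0) (eta_neq1 :
  eta != 1).
Hypothesis delta_neq0 : delta != 0.
Hypothesis qnum_inj : forall m n, m != n -> qnum eta m.+1 != 0 ->
  n.+1%:R * qnum eta m.+1 != m.+1%:R * qnum eta n.+1.
Hypothesis duE : forall v, d (u v) = u (d v) + h v + delta *: v.
Hypothesis huE : forall v, h (u v) = eta *: u (h v).
Hypothesis dhE : forall v, d (h v) = eta *: h (d v).
Variables (n : nat) (psi : {linear V -> 'rV[K]_n}) (phi : {linear 'rV[K]_n ->
  V}).
Hypotheses (psiK : cancel psi phi) (phiK : cancel phi psi).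

(* The last clause is [ker_d_im_u] for left multiplication on square matrices,
   where the roles of [d] and [u] are exchanged: it says that a functional
   vanishing on [ker d + im u] is zero. *)
Lemma finite_dim_structure :
  [/\ exists N, forall v, iter N d v = 0, exists N, forall v, iter N u v = 0
    & forall v, exists k t, v = k + u t /\ d k = 0].
Proof.
case: n psi phi psiK phiK => [|n'] psi' phi' psiK' phiK'.
  have V0 (v : V) : v = 0.
    by rewrite -[v]psiK' [psi' v](_ : _ = 0) ?linear0 //; apply/rowP => -[].
  split; [by exists 0%N => v; rewrite /= [v]V0..|].
  by move=> v; exists 0, 0; rewrite !linear0 addr0 [v]V0.
pose mx (f : {linear V -> V}) := lin1_mx (psi' \o f \o phi').
have psi_mx (f : {linear V -> V}) v : psi' (f v) = psi' v *m mx f.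
  by rewrite mul_rV_lin1 /= psiK'.
have mx_inj (A B : 'M[K]_n'.+1) : (forall v, psi' v *m A = psi' v *m B) ->
  A = B.
  move=> AB; apply/row_matrixP => i; rewrite !rowE.
  by rewrite -[delta_mx 0 i]phiK' AB.
have iter_mx (f : {linear V -> V}) N : mx f ^+ N = 0 ->
  forall v, iter N f v = 0.
  move=> fN0 v; apply: (can_inj psiK'); rewrite linear0.
  suff -> : psi' (iter N f v) = psi' v *m (mx f ^+ N) by rewrite fN0 mulmx0.
  elim: N {fN0} => [|N IHN]; first by rewrite expr0 mulmx1.
  by rewrite exprSr -mulmxE mulmxA -IHN -psi_mx.
set D := mx d; set U := mx u; set H := mx h.
(* Matrices act on row vectors from the right, so [U *m D] represents [d] after [u]. *)
have UD : U *m D = D *m U + H + delta%:M.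
  apply: mx_inj => v; rewrite !mulmxDr !mulmxA -!psi_mx mul_mx_scalar duE.
  by rewrite !linearD linearZ.
have UH : U *m H = eta *: (H *m U).
  by apply: mx_inj => v; rewrite -scalemxAr !mulmxA -!psi_mx huE linearZ.
have HD : H *m D = eta *: (D *m H).
  by apply: mx_inj => v; rewrite -scalemxAr !mulmxA -!psi_mx dhE linearZ.
have [ND DN] : exists N, D ^+ N = 0.
  apply: (commutator_scaled_nilpotent (B := U) (H := - H) (delta :=
    - delta) charK0 eta_neq1).
  - by rewrite oppr_eq0.
  - rewrite -!mulmxE UD !opprD raddfN /= !addrA subrr sub0r.
    by rewrite addrC.
  - by rewrite mulNr mulrN -!mulmxE HD scalerN.
have [NU UN] : exists N, U ^+ N = 0.
  apply: (commutator_scaled_nilpotent (B := D) (H := H) (c :=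
    eta^-1) charK0 _ delta_neq0).
  - by rewrite invr_eq1.
  - by apply/eqP; rewrite subr_eq -!mulmxE UD -addrA addrC.
  - by rewrite -!mulmxE UH scalerA mulVf ?scale1r.
split; [exists ND; exact: iter_mx|exists NU; exact: iter_mx|move=> v].
have iter_mul (A B : 'M[K]_n'.+1) N : iter N (mulmx A) B = A ^+ N *m B.
  elim: N => [|N IHN]; first by rewrite expr0 mul1mx.
  by rewrite iterS IHN exprS -mulmxE mulmxA.
have UDB0 (B : 'M[K]_n'.+1) : U *m (D *m B) = 0 -> D *m B = 0.
  pose lin (A : 'M[K]_n'.+1) : {linear 'M[K]_n'.+1 -> 'M[K]_n'.+1} := mulmx A.
  apply: (@ker_d_im_u _ eta delta _ (lin U) (lin D) (lin H)) => // w.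
  - by rewrite /= !mulmxA UD !mulmxDl mul_scalar_mx.
  - by rewrite /= !mulmxA HD -scalemxAl.
  - by rewrite /= !mulmxA UH -scalemxAl.
  - by exists NU; rewrite iter_mul UN mul0mx.
  - by exists ND; rewrite iter_mul DN mul0mx.
have [k [t [vE kD]]] := kermx_add_full UDB0 (psi' v).
exists (phi' k), (phi' t); split; apply: (can_inj psiK').
  by rewrite linearD psi_mx !phiK' vE.
by rewrite psi_mx phiK' kD linear0.
Qed.

End FiniteDimension.

(** * Semisimplicity of finite dimensional modules *)

Section DownUpSemisimple.
Variables (K : fieldType) (eta gamma : K).
Hypotheses (charK0 : [pchar K] =i pred0) (eta_neq0 : eta != 0) (eta_neq1 :
  eta != 1).
Hypothesis gamma_neq0 : gamma != 0.
Hypothesis qnum_inj : forall m n, m != n -> qnum eta m.+1 != 0 ->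
  n.+1%:R * qnum eta m.+1 != m.+1%:R * qnum eta n.+1.
Local Notation A := (down_up (1 + eta) (- eta) gamma).
Local Notation d := (@du_d K (1 + eta) (- eta) gamma).
Local Notation u := (@du_u K (1 + eta) (- eta) gamma).
Let delta := gamma / (1 - eta).
Let h : A := d * u - u * d - delta%:A.

Fact delta_neq0 : delta != 0.
Proof. by rewrite mulf_neq0 // invr_eq0 subr_eq0 eq_sym. Qed.

Fact gammaE : gamma = delta - eta * delta.
Proof.
by rewrite -{1}[delta]mul1r -mulrBl mulrC divfK // subr_eq0 eq_sym.
Qed.

(** The computation common to [h u = eta u h] and [d h = eta h d]; it rests on
    [gamma = (1 - eta) delta]. *)
Fact weight_shift (W : lmodType K) (x y z : W) :
  (1 + eta) *: x + (- eta) *: y + gamma *: z - x - delta *: z =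
  eta *: (x - y - delta *: z).
Proof.
rewrite gammaE scalerBl -addrA addrACA [_ *: z - _ - _]addrAC subrr add0r.
rewrite [_ + _ - x]addrAC scalerDl scale1r [x + eta *:
  x]addrC addrK !scalerBr scaleNr.
by rewrite scalerA.
Qed.

Fact du_hu : h * u = eta *: (u * h).
Proof.
rewrite /h !mulrBl !mulrBr mulr_algl mulr_algr du_rel_u !mulrA.
exact: weight_shift.
Qed.

Fact du_dh : d * h = eta *: (h * d).
Proof.
rewrite /h !mulrBl !mulrBr mulr_algl mulr_algr !mulrA du_rel_d.
exact: weight_shift.
Qed.

Fact du_du : d * u = u * d + h + delta%:A.
Proof. by rewrite /h addrA subrK addrC subrK. Qed.

Section Module.
Variable M : lmodType A.
Hypothesis fdM : finite_dimensional M.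
Local Notation V := (scalar_restriction M).

Let dV : {linear V -> V} := alg_act d.
Let uV : {linear V -> V} := alg_act u.
Let hV : {linear V -> V} := alg_act h.

Fact duV v : dV (uV v) = uV (dV v) + hV v + delta *: v.
Proof. by rewrite /= /alg_act !scalerA du_du !scalerDl. Qed.

Fact huV v : hV (uV v) = eta *: uV (hV v).
Proof.
by rewrite /= /alg_act scalar_restrictionE !scalerA -mulrA mulr_algl du_hu.
Qed.

Fact dhV v : dV (hV v) = eta *: hV (dV v).
Proof.
by rewrite /= /alg_act scalar_restrictionE !scalerA -mulrA mulr_algl du_dh.
Qed.

Let structure : [/\ exists N, forall v, iter N dV v = 0,
    exists N, forall v, iter N uV v = 0
  & forall v, exists k t, v = k + uV t /\ dV k = 0].
Proof.
have [n [psi [phi [psiK phiK]]]] := finite_dimensional_coord fdM.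
exact: (finite_dim_structure charK0 eta_neq0 eta_neq1 delta_neq0 qnum_inj
  duV huV dhV psiK phiK).
Qed.

Let dV_nilp v : exists n, iter n dV v = 0.
Proof. by have [[N dN] _ _] := structure; exists N. Qed.

Let uV_nilp v : exists n, iter n uV v = 0.
Proof. by have [_ [N uN] _] := structure; exists N. Qed.

Local Notation singularV := (singular eta delta dV hV).

(** The span [L] of [v, u v, ..., u^n v] is a submodule because [u^(n+1) v = 0]. Hence it contains
    [a *: v], which a power of [d] brings back to a multiple of [v]. *)
Lemma singular_simple_vector n (v : V) : singularV n v -> v != 0 ->
  simple_vector (v : M).
Proof.
move=> sv v0; split=> // a av0.
pose L : {pred M} := [pred x | `[< exists c : nat -> K,
  x = \sum_(i < n.+1) c i *: iter i uV v :> V >]].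
have [dv0 _] := sv.
have top : iter n.+1 uV v = 0.
  exact: (singular_top charK0 eta_neq0 delta_neq0 qnum_inj duV huV dhV dV_nilp
    uV_nilp sv).
have sL : submod_closed L.
  apply: down_up_submod_closed => [|x y|c x|x|x].
  - by apply/asboolP; exists (fun=> 0); rewrite big1 // => i _; rewrite scale0r.
  - move=> /asboolP[a1 ->] /asboolP[a2 ->]; apply/asboolP.
    exists (fun i => a1 i + a2 i); rewrite -[LHS]big_split /=.
    by apply: eq_bigr => i _; rewrite scalerDl.
  - move=> /asboolP[a1 ->]; apply/asboolP; exists (fun i => c * a1 i).
    rewrite -scalar_restrictionE scaler_sumr.
    by apply: eq_bigr => i _; rewrite scalerA.
  - move=> /asboolP[a1 ->]; apply/asboolP.
    exists (fun i => if (i < n)%N then a1 i.+1 * (qnum eta i.+1 *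
      - (n.+1%:R * delta / qnum eta n.+1) + i.+1%:R * delta) else 0).
    rewrite -[LHS]/(dV _) linear_sum big_ord_recl big_ord_recr /= ltnn scale0r
      addr0.
    rewrite linearZ /= [alg_act _ _]dv0 scaler0 add0r; apply: eq_bigr => i _.
    rewrite ltn_ord linearZ /=.
    have := singular_d_iter_u charK0 delta_neq0 duV huV i sv v0.
    by rewrite /= => ->; rewrite scalerA.
  - move=> /asboolP[a1 ->]; apply/asboolP.
    exists (fun i => if i is j.+1 then a1 j else 0).
    rewrite -[LHS]/(uV _) linear_sum big_ord_recr big_ord_recl /= scale0r add0r.
    rewrite linearZ /= [alg_act _ _]top scaler0 addr0; apply: eq_bigr => i _.
    by rewrite linearZ.
have /asboolP[c xE] : a *: (v : M) \in L.
  apply: submod_closedMl => //; apply/asboolP; exists (fun i => (i == 0)%:R).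
  by rewrite big_ord_recl big1 ?addr0 ?scale1r // => i _; rewrite scale0r.
have := singular_highest_weight charK0 delta_neq0 qnum_inj duV huV sv (leqnn
  n.+1) (c := c).
rewrite -xE => /(_ av0)[j [b bE]]; exists (b%:A * d ^+ j).
by rewrite -scalerA -iter_alg_act.
Qed.

Lemma finite_dimensional_semisimple : semisimple M.
Proof.
pose good (v : V) := exists2 vs : seq M,
  {in vs, forall w, simple_vector w} & generated vs (v : M).
have good0 : good 0 by exists [::] => //; exact: generated0.
have goodD v w : good v -> good w -> good (v + w).
  move=> [vs simv gv] [ws simw gw]; exists (vs ++ ws).
    by move=> x; rewrite mem_cat => /orP[/simv|/simw].
  apply: generatedD; [move: gv|move: gw]; apply: generated_trans => x xs;
    by apply: generated_mem; rewrite mem_cat xs ?orbT.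
have goodu N v : good v -> good (iter N uV v).
  move=> [vs simv gv]; exists vs => //; rewrite iter_alg_act.
  exact: generatedZ.
have good_ker k : dV k = 0 -> good k.
  move=> dk0; have [N uN] := uV_nilp k.
  have [f -> sf] := ker_d_decomp charK0 delta_neq0 qnum_inj duV huV dhV dk0 uN.
  elim/big_ind: _ => [//||i _]; first exact: goodD.
  have [->//|fi0] := eqVneq (f i) 0.
  exists [:: (f i : M)]; last by apply: generated_mem; rewrite mem_head.
  by move=> w; rewrite inE => /eqP->; exact: singular_simple_vector (sf i) fi0.
have good_all v : good v.
  have [_ [N uN] dec] := structure.
  (* Iterating [M = ker d + u M] shows that, modulo good vectors, [v] is of the form [u^N w] for
     every [N], and [u^N = 0] for a suitable [N]. *)
  suff [w gw] : exists w, good (v - iter N uV w) by rewrite uN subr0 in gw.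
  elim: N {uN} => [|N [w gw]].
    by exists v; rewrite subrr.
  have [k [t [wE dk0]]] := dec w.
  exists t; rewrite (_ : _ - _ = v - iter N uV w + iter N uV k).
    by apply: goodD => //; apply/goodu/good_ker.
  by rewrite [in RHS]wE linearD opprD addrA addrAC subrK iterSr.
have [n [e eP]] := fdM.
have /choice[f fP] : forall i, exists vs : seq M,
    {in vs, forall w, simple_vector w} /\ generated vs (e i).
  by move=> i; have [vs] := good_all (e i); exists vs.
apply: (semisimple_of_simple_vectors (vs := flatten [seq f i | i : 'I_n])).
  move=> w /flattenP[s /mapP[i _ ->]]; exact: (fP i).1.
move=> x; have [c ->] := eP x; apply: generated_sum => i; apply: generatedZ.
apply: generated_trans (fP i).2 => w fw; apply: generated_mem.
by apply/flattenP; exists (f i) => //; apply: map_f; rewrite mem_enum.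
Qed.

End Module.
End DownUpSemisimple.

(** * Equivalence of the three conditions *)

Theorem theorem5p4 (K : closedFieldType) (charK0 : [pchar K] =i pred0)
    (eta gamma : K) (eta_neq0 : eta != 0) (eta_neq1 : eta != 1)
    (gamma_neq0 : gamma != 0) :
  [<-> (forall M : lmodType (down_up (1 + eta) (- eta) gamma),
          finite_dimensional M -> semisimple M);
       (forall lambda : K,
          composition_length_le (verma (1 + eta) (- eta) gamma lambda) 2);
       (forall m n : nat, (0 < m)%N -> (0 < n)%N -> m != n ->
          eta \notin X_set m n)].
Proof.
have two_zeros m n : (0 < m)%N -> (0 < n)%N -> m != n -> eta \in X_set m n ->
    exists lambda k l, [/\ (k < l)%N,
      verma_weight (1 + eta) (- eta) gamma lambda k.+1 = 0 &
      verma_weight (1 + eta) (- eta) gamma lambda l.+1 = 0].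
  case: m n => [//|m] [//|n] _ _ nemn etaX.
  have [lambda [lm ln]] := X_set_verma_weight gamma eta_neq1 etaX.
  exists lambda; move: nemn; rewrite eqSS neq_ltn => /orP[ltmn|ltnm].
    by exists m, n.
  by exists n, m.
have le2 : (forall m n : nat, (0 < m)%N -> (0 < n)%N -> m != n ->
      eta \notin X_set m n) ->
    forall lambda, composition_length_le (verma (1 + eta) (- eta) gamma
      lambda) 2.
  move=> etaX lambda; apply: verma_composition_length_le2.
  have qinj := qnum_inj_of_X_set charK0 eta_neq1 eta_neq0 etaX.
  exact: (verma_weight_inj charK0 eta_neq1 gamma_neq0 qinj).
tfae.
- move=> ss; apply: le2 => m n m0 n0 nemn;
    apply/negP => /(two_zeros m n m0 n0 nemn).
  move=> [lambda [k [l [ltkl lk ll]]]].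
  have fd := trunc_verma_finite_dimensional ll.
  exact: (trunc_verma_not_semisimple (m := k.+1) _ lk (ss _ fd)).
- move=> len m n m0 n0 nemn; apply/negP => /(two_zeros m n m0 n0 nemn).
  move=> [lambda [k [l [ltkl lk ll]]]].
  exact: (verma_composition_length_gt2 ltkl lk ll (len lambda)).
- move=> etaX M fdM; apply: finite_dimensional_semisimple => //.
  exact: qnum_inj_of_X_set charK0 eta_neq1 eta_neq0 etaX.
Qed.
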